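(* Let $\mathcal{M}$ be an edge-transitive map embedding a complete graph $K_n$. Then $\mathcal{M}$ is isomorphic to one of the following maps, or to the Petrie dual of one of them: (i) $\mathcal{M}_n(c)$, where $n$ is a prime power and $c$ is a primitive element of the field $\mathbb{F}_n$; (ii) one of the four non-orientable regular maps $\{6,2\}_3$, $\{4,3\}_3$, $\{3,5\}_5$ and $\{5,5\}_3$, embedding $K_n$ for $n=3,4,6$ and $6$ respectively; (iii) $\mathcal{M}_n(c,j)$, where $3<n=p^e\equiv 3 \pmod 4$ with $p$ prime, $c$ is a primitive element of $\mathbb{F}_n$, and $j\in\mathbb{Z}_{n-1}\setminus\{1\}$ is odd. In particular, $n$ is either $6$ or a prime power.
   Context: Let $\Gamma=\langle R_0,R_1,R_2\mid R_i^2=(R_0R_2)^2=1\rangle$. A (connected) map $\mathcal{M}$ (possibly non-orientable or with non-empty boundary) is identified, up to isomorphism, with a transitive permutation representation of $\Gamma$ on a set $\Phi$ of flags; vertices, edges and faces are the orbits on $\Phi$ of $\langle R_1,R_2\rangle$, $\langle R_0,R_2\rangle$ and $\langle R_0,R_1\rangle$, incident when they intersect. $\mathrm{Aut}\,\mathcal{M}$ is the centraliser of $\Gamma$ in $\mathrm{Sym}\,\Phi$; $\mathcal{M}$ is edge-transitive if $\mathrm{Aut}\,\mathcal{M}$ is transitive on edges, and regular if it is transitive on flags. The Petrie dual of $\mathcal{M}$ is the map obtained by composing the representation with the automorphism of $\Gamma$ which fixes $R_1$ and $R_2$ and transposes $R_0$ and $R_0R_2$; it embeds the same graph, with faces replaced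 by Petrie polygons (closed zig-zag paths). A map embeds a graph if that graph is formed by its vertices and edges. A primitive element $c$ of $\mathbb{F}_n$ is a generator of the cyclic group $\mathbb{F}_n^*=\mathbb{F}_n\setminus\{0\}$. Given a cyclic ordering $(x_1,x_2,\ldots,x_{n-1})$ of $\mathbb{F}_n^*$, the corresponding Cayley map for the additive group of $\mathbb{F}_n$ is the orientable map without boundary, embedding $K_n$ with vertex set $\mathbb{F}_n$, in which the neighbours of each vertex $v$ follow the cyclic order $v+x_1,v+x_2,\ldots,v+x_{n-1}$ around $v$, in accordance with a fixed orientation. $\mathcal{M}_n(c)$ is the Cayley map with cyclic ordering $1,c,c^2,\ldots,c^{n-2}$. $\mathcal{M}_n(c,j)$ is the Cayley map with cyclic ordering $1,c^j,c^2,c^{j+2},c^4,c^{j+4},\ldots,c^{n-3},c^{j+n-3}$. The maps $\{6,2\}_3$, $\{4,3\}_3$ and $\{3,5\}_5$ on the real projective plane are the antipodal quotients of the hexagonal map $\{6,2\}$ (a circuit of length $6$ along the equator), the cube and the icosahedron on the sphere; $\{5,5\}_3$ is the Petrie dual of $\{3,5\}_5$.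
   Formalization: The map is assumed to have empty boundary (no flag is fixed by R_0, R_1 or R_2): with boundary allowed the claim is false, e.g. the triangle K_3 bounding a disc is edge-transitive but not isomorphic to any listed map or Petrie dual, all of which have no boundary. *)

(* Defs.v *)
From HB Require Import structures.
From mathcomp Require Import all_boot all_order all_algebra all_fingroup.
From mathcomp Require Import all_solvable all_field.
From mathcomp Require Import zify.

Set Implicit Arguments.
Unset Strict Implicit.
Unset Printing Implicit Defensive.

Import GroupScope GRing.Theory.

(* A permutation representation of
   Gamma = < R_0, R_1, R_2 | R_i^2 = (R_0 R_2)^2 = 1 >.
   Products in {perm T} act from left to right: (R_0 * R_2) x = R_2 (R_0 x).
   The flag set is finite, as it must be for a map with finitely many edges:
   an edge is an orbit of <R_0, R_2>, hence carries at most 4 flags.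
   Transitivity of the representation is the separate predicate [connected]. *)
Record gmap := GMap {
  flag : finType;
  R_0 : {perm flag};
  R_1 : {perm flag};
  R_2 : {perm flag};
  R_0_sq : R_0 ^+ 2 = 1;
  R_1_sq : R_1 ^+ 2 = 1;
  R_2_sq : R_2 ^+ 2 = 1;
  R_02_sq : (R_0 * R_2) ^+ 2 = 1 }.

Section MapNotions.
Variable M : gmap.

Definition monodromy : {group {perm flag M}} :=
  <<[set R_0 M; R_1 M; R_2 M]>>%G.

Definition connected : bool :=
  [transitive monodromy, on [set: flag M] | 'P].

Definition vertices : {set {set flag M}} :=
  orbit 'P <<[set R_1 M; R_2 M]>> @: [set: flag M].
Definition edges : {set {set flag M}} :=
  orbit 'P <<[set R_0 M; R_2 M]>> @: [set: flag M].

Definition incident (A B : {set flag M}) : bool := A :&: B != set0.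

Definition Aut_map : {group {perm flag M}} := 'C(monodromy)%G.

Definition edge_transitive : bool :=
  [transitive Aut_map, on edges | 'P^*].

(* A flag fixed by one of R_0, R_1, R_2 has a side on the boundary of the
   underlying surface.  For example, the triangle K_3 bounding a disc is the
   regular map with 6 flags in which R_2 is trivial. *)
Definition boundaryless : Prop :=
  forall x : flag M, [/\ R_0 M x != x, R_1 M x != x & R_2 M x != x].

Definition ends (E : {set flag M}) : {set {set flag M}} :=
  [set X in vertices | incident X E].

(* M embeds the simple graph (V, adj).  For an irreflexive adj the condition on
   the set of all [ends E] excludes loops and edges with a single end, while
   injectivity of [ends] excludes multiple edges. *)
Definition embeds (V : finType) (adj : rel V) : Prop :=
  exists f : V -> {set flag M},
    [/\ injective f,
        f @: [set: V] = vertices,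
        {in edges &, injective ends} &
        ends @: edges =
          [set [set f u; f v] | u in [set: V], v in [set: V] & adj u v]].

End MapNotions.

Definition complete_graph (n : nat) : rel 'I_n := fun u v => u != v.
Arguments complete_graph : clear implicits.

Definition map_iso (M N : gmap) : Prop :=
  exists f : flag M -> flag N,
    [/\ bijective f,
        (forall x, f (R_0 M x) = R_0 N (f x)),
        (forall x, f (R_1 M x) = R_1 N (f x)) &
        (forall x, f (R_2 M x) = R_2 N (f x))].

Fact petrie_R0_sq (M : gmap) : (R_0 M * R_2 M) ^+ 2 = 1.
Proof. exact: R_02_sq. Qed.

Fact petrie_R02_sq (M : gmap) : (R_0 M * R_2 M * R_2 M) ^+ 2 = 1.
Proof. by rewrite -mulgA -[R_2 M * _]/(R_2 M ^+ 2) R_2_sq mulg1 R_0_sq. Qed.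

Definition petrie_dual (M : gmap) : gmap :=
  GMap (petrie_R0_sq M) (R_1_sq M) (R_2_sq M) (petrie_R02_sq M).

Definition iso_up_to_petrie (M N : gmap) : Prop :=
  map_iso M N \/ map_iso M (petrie_dual N).

Section MakeMap.
Variables (T : finType) (f0 f1 f2 : T -> T).
Hypotheses (f0K : involutive f0) (f1K : involutive f1) (f2K : involutive f2).
Hypothesis f02C : forall x, f0 (f2 x) = f2 (f0 x).

Fact invol_perm_sq (f : T -> T) (fK : involutive f) :
  perm (inv_inj fK) ^+ 2 = 1.
Proof. by apply/permP=> x; rewrite expgS expg1 permM !permE fK. Qed.

Fact invol_perm02_sq : (perm (inv_inj f0K) * perm (inv_inj f2K)) ^+ 2 = 1.
Proof.
by apply/permP=> x; rewrite expgS expg1 !permM !permE f02C f2K f0K.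
Qed.

Definition mk_map : gmap :=
  GMap (invol_perm_sq f0K) (invol_perm_sq f1K) (invol_perm_sq f2K)
       invol_perm02_sq.

Fact mk_map_aut (a : {perm T}) :
    (forall x, a (f0 x) = f0 (a x)) -> (forall x, a (f1 x) = f1 (a x)) ->
    (forall x, a (f2 x) = f2 (a x)) ->
  (<[a]> \subset Aut_map mk_map)%g.
Proof.
move=> c0 c1 c2; rewrite cycle_subG /= cent_gen; apply/centP=> r.
by rewrite !inE -orbA => /or3P[] /eqP->; apply/permP=> x; rewrite !permM !permE.
Qed.

End MakeMap.

Section Quotient.
Variables (M : gmap) (A : {group {perm flag M}}).
Hypothesis sAM : A \subset Aut_map M.

Definition quotient_flag : finType :=
  {B : {set flag M} | B \in orbit 'P A @: [set: flag M]}.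

Fact quotient_subproof (r : {perm flag M}) (B : quotient_flag) :
  r \in monodromy M -> r @: val B \in orbit 'P A @: [set: flag M].
Proof.
move=> Gr; case: B => B /= /imsetP[x _ ->]; apply/imsetP; exists (r x) => //.
rewrite /orbit -imset_comp; apply: eq_in_imset => a /(subsetP sAM) aM /=.
have/permP/(_ x) := centP aM r Gr.
by rewrite !permM /aperm => ->.
Qed.

Fact R0_monodromy : R_0 M \in monodromy M.
Proof. by rewrite mem_gen // !inE eqxx. Qed.
Fact R1_monodromy : R_1 M \in monodromy M.
Proof. by rewrite mem_gen // !inE eqxx orbT. Qed.
Fact R2_monodromy : R_2 M \in monodromy M.
Proof. by rewrite mem_gen // !inE eqxx orbT. Qed.

Definition quotient_act (r : {perm flag M}) (Gr : r \in monodromy M)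
    (B : quotient_flag) : quotient_flag :=
  exist _ (r @: val B) (quotient_subproof B Gr).

Fact quotient_actK r (Gr : r \in monodromy M) :
  r ^+ 2 = 1 -> involutive (quotient_act Gr).
Proof.
move=> R_2 B; apply: val_inj => /=; rewrite -imset_comp.
rewrite (eq_imset (g := id)) ?imset_id // => x /=.
by rewrite -permM -[r * r]/(r ^+ 2) R_2 perm1.
Qed.

Fact quotient_actC B :
  quotient_act R0_monodromy (quotient_act R2_monodromy B) =
  quotient_act R2_monodromy (quotient_act R0_monodromy B).
Proof.
apply: val_inj; rewrite /= -!imset_comp; apply: eq_imset => x /=.
rewrite -!permM; congr (fun_of_perm _ x).
have := R_02_sq M; rewrite expgS expg1 => /eqP; rewrite -eq_invg_mul invMg.
have inv r : r ^+ 2 = 1 -> r^-1 = r :> {perm flag M}.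
  by rewrite expgS expg1 => /eqP; rewrite -eq_invg_mul => /eqP.
by rewrite !inv ?R_0_sq ?R_2_sq // => /eqP.
Qed.

Definition quotient_map : gmap :=
  mk_map (quotient_actK R0_monodromy (R_0_sq M))
         (quotient_actK R1_monodromy (R_1_sq M))
         (quotient_actK R2_monodromy (R_2_sq M)) quotient_actC.

End Quotient.

(* F^* is the group {unit F}.  The sequence x_1, ..., x_(n-1) is read
   cyclically, so that [next] and [prev] give the successor and predecessor. *)
Record cyclic_ordering (F : finFieldType) := CyclicOrdering {
  ord_seq :> seq {unit F};
  ord_seq_uniq : uniq ord_seq;
  ord_seq_full : forall x : {unit F}, x \in ord_seq }.

Definition oppu (F : finFieldType) (x : {unit F}) : {unit F} :=
  insubd x (- val x)%R.

Fact val_oppu (F : finFieldType) (x : {unit F}) : val (oppu x) = (- val x)%R.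
Proof. by rewrite /oppu val_insubd unitrN (valP x). Qed.

Section CayleyMap.
Variables (F : finFieldType) (s : cyclic_ordering F).

(* The flag ((v, x), true) lies at the vertex v, on the edge from v to v + x and
   on the side of that edge facing the edge to v + next x in the local
   orientation at v; ((v, x), false) lies on the other side.  The orientations
   at v and v + x agree, so the side of an edge read from its other end is
   labelled by the opposite boolean. *)
Definition cayley_flag : finType := (F * {unit F} * bool)%type.

Definition cayley_R0 (t : cayley_flag) : cayley_flag :=
  let: (v, x, b) := t in ((v + val x)%R, oppu x, ~~ b).
Definition cayley_R1 (t : cayley_flag) : cayley_flag :=
  let: (v, x, b) := t in (v, if b then next s x else prev s x, ~~ b).
Definition cayley_R2 (t : cayley_flag) : cayley_flag :=
  let: (v, x, b) := t in (v, x, ~~ b).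

Fact cayley_R0K : involutive cayley_R0.
Proof.
case=> [[v x] b] /=; rewrite val_oppu addrK negbK; congr (_, _, _).
by apply: val_inj; rewrite !val_oppu opprK.
Qed.

Fact cayley_R1K : involutive cayley_R1.
Proof.
case=> [[v x] []] /=; first by rewrite prev_next // ord_seq_uniq.
by rewrite next_prev // ord_seq_uniq.
Qed.

Fact cayley_R2K : involutive cayley_R2.
Proof. by case=> [[v x] b] /=; rewrite negbK. Qed.

Fact cayley_R02C t : cayley_R0 (cayley_R2 t) = cayley_R2 (cayley_R0 t).
Proof. by case: t => [[v x] b]. Qed.

Definition cayley_map : gmap :=
  mk_map cayley_R0K cayley_R1K cayley_R2K cayley_R02C.

End CayleyMap.

Definition primitive_element (F : finFieldType) (c : {unit F}) : bool :=
  generator [set: {unit F}] c.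

Section Orderings.
Variables (F : finFieldType) (c : {unit F}).
Hypothesis c_prim : primitive_element c.

Fact primitive_exp (x : {unit F}) : exists k, x = c ^+ k.
Proof.
have: x \in [set: {unit F}] by rewrite inE.
by rewrite (eqP c_prim) => /cycleP.
Qed.

Fact primitive_order : #[c] = #|F|.-1.
Proof. by rewrite orderE -(eqP c_prim) card_finField_unit. Qed.

Definition power_seq : seq {unit F} := [seq c ^+ i | i <- iota 0 #|F|.-1].

Fact full_seq_uniq (s : seq {unit F}) :
  size s = #|F|.-1 -> (forall x, x \in s) -> uniq s.
Proof.
move=> sz full; apply/card_uniqP; rewrite sz -card_finField_unit cardsT.
by apply: eq_card => x; rewrite full.
Qed.

Fact power_seq_full x : x \in power_seq.
Proof.
have [k ->] := primitive_exp x; apply/mapP; exists (k %% #|F|.-1).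
  by rewrite mem_iota /= add0n ltn_mod -primitive_order order_gt0.
by rewrite -primitive_order expg_mod_order.
Qed.

Fact power_seq_uniq : uniq power_seq.
Proof. by apply: full_seq_uniq power_seq_full; rewrite size_map size_iota. Qed.

Definition power_ordering : cyclic_ordering F :=
  CyclicOrdering power_seq_uniq power_seq_full.

Variable j : nat.
Hypotheses (F_odd : odd #|F|) (j_odd : odd j).

(* 1, c^j, c^2, c^(j+2), ..., c^(n-3), c^(j+n-3) *)
Definition shuffled_seq : seq {unit F} :=
  flatten [seq [:: c ^+ (2 * i); c ^+ (j + 2 * i)] | i <- iota 0 #|F|.-1./2].

Fact shuffled_seq_full x : x \in shuffled_seq.
Proof.
have [k ->] := primitive_exp x.
have F1: 1 < #|F| by rewrite finNzRing_gt1.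
have m_even : #|F|.-1 = (2 * #|F|.-1./2)%N by lia.
set h := #|F|.-1./2 in m_even *.
have h0 : 0 < h by lia.
have mod2 i : 2 * i = 2 * (i %% h) %[mod 2 * h].
  by rewrite -!muln_modr modn_mod.
have expE a b : a = b %[mod 2 * h] -> c ^+ a = c ^+ b.
  by move=> eab; apply/eqP; rewrite eq_expg_mod_order primitive_order m_even eab.
have [k_odd | k_even] := boolP (odd k).
  pose i := ((k + 2 * h * j - j)./2)%N.
  apply/flatten_mapP; exists (i %% h); first by rewrite mem_iota /= ltn_mod.
  rewrite !inE; apply/orP; right; apply/eqP/expE.
  have -> : j + 2 * (i %% h) = j + 2 * i %[mod 2 * h].
    by rewrite -[in LHS]modnDmr -mod2 modnDmr.
  have -> : (j + 2 * i = j * (2 * h) + k)%N.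
    have jle : (j <= 2 * h * j)%N by rewrite leq_pmull // muln_gt0.
    have : ~~ odd (k + 2 * h * j - j)%N.
      rewrite oddB; last exact: leq_trans (leq_addl _ _).
      by rewrite oddD -mulnA oddM /= k_odd j_odd.
    rewrite -/i => ev; have := even_halfK ev; rewrite -/i; lia.
  by rewrite modnMDl.
apply/flatten_mapP; exists (k./2 %% h); first by rewrite mem_iota /= ltn_mod.
rewrite !inE; apply/orP; left; apply/eqP/expE.
by rewrite -mod2; congr (_ %% _); rewrite mul2n -[LHS](even_halfK k_even).
Qed.

Fact shuffled_seq_uniq : uniq shuffled_seq.
Proof.
apply: full_seq_uniq shuffled_seq_full.
rewrite size_flatten /shape -map_comp /= sumnE big_map.
rewrite (eq_bigr (fun=> 2)) // big_const_seq count_predT size_iota iter_addn_0.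
by rewrite mul2n even_halfK //; case: #|F| F_odd => //= m /negPf->.
Qed.

Definition shuffled_ordering : cyclic_ordering F :=
  CyclicOrdering shuffled_seq_uniq shuffled_seq_full.

End Orderings.

Definition M_c (F : finFieldType) (c : {unit F}) (hc : primitive_element c) :
  gmap := cayley_map (power_ordering hc).

Definition M_cj (F : finFieldType) (c : {unit F}) (j : nat)
    (hc : primitive_element c) (hF : odd #|F|) (hj : odd j) : gmap :=
  cayley_map (shuffled_ordering hc hF hj).

Definition prime_power (n : nat) : Prop :=
  exists p e : nat, [/\ prime p, 0 < e & n = p ^ e]%N.

(* ((v, d), f): the vertex v, the edge leaving v in the direction d along the
   equator, and one of the two hemispheres. *)
Definition hex_flag : finType := ('Z_6 * bool * bool)%type.

Definition hex_R0 (t : hex_flag) : hex_flag :=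
  let: (v, d, f) := t in ((if d then v + 1 else v - 1)%R, ~~ d, f).
Definition hex_R1 (t : hex_flag) : hex_flag :=
  let: (v, d, f) := t in (v, ~~ d, f).
Definition hex_R2 (t : hex_flag) : hex_flag :=
  let: (v, d, f) := t in (v, d, ~~ f).
Definition hex_antipode_fun (t : hex_flag) : hex_flag :=
  let: (v, d, f) := t in ((v + 3%:R)%R, d, ~~ f).

Fact hex_R0K : involutive hex_R0.
Proof. by case=> [[v []] f] /=; rewrite ?addrK ?subrK. Qed.
Fact hex_R1K : involutive hex_R1.
Proof. by case=> [[v d] f] /=; rewrite negbK. Qed.
Fact hex_R2K : involutive hex_R2.
Proof. by case=> [[v d] f] /=; rewrite negbK. Qed.
Fact hex_R02C t : hex_R0 (hex_R2 t) = hex_R2 (hex_R0 t).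
Proof. by case: t => [[v d] f]. Qed.

Definition hex_map : gmap := mk_map hex_R0K hex_R1K hex_R2K hex_R02C.

Fact hex_antipodeK : involutive hex_antipode_fun.
Proof.
case=> [[v d] f] /=; rewrite negbK -addrA; congr (_, _, _).
by rewrite -natrD (_ : (3 + 3)%:R = 0 :> 'Z_6)%R ?addr0 //; apply: val_inj.
Qed.

Definition hex_antipode : {perm hex_flag} := perm (inv_inj hex_antipodeK).

Fact hex_antipode_aut : <[hex_antipode]> \subset Aut_map hex_map.
Proof.
by apply: mk_map_aut => -[[v d] f]; rewrite !permE //=; case: d;
  rewrite addrAC.
Qed.

Definition map_62_3 : gmap := @quotient_map hex_map <[hex_antipode]>%G hex_antipode_aut.

(* The cube has vertex set {0,1}^3.  (v, s): the vertex v, the edge through v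
   parallel to the axis s 0, and the face through that edge spanned by the axes
   s 0 and s 1, hence orthogonal to the axis s 2. *)
Definition cube_flag : finType := ({ffun 'I_3 -> bool} * {perm 'I_3})%type.

Definition ax0 : 'I_3 := inord 0.
Definition ax1 : 'I_3 := inord 1.
Definition ax2 : 'I_3 := inord 2.

Definition cube_R0 (t : cube_flag) : cube_flag :=
  ([ffun k => t.1 k (+) (k == t.2 ax0)], t.2).
Definition cube_R1 (t : cube_flag) : cube_flag := (t.1, tperm ax0 ax1 * t.2).
Definition cube_R2 (t : cube_flag) : cube_flag := (t.1, tperm ax1 ax2 * t.2).
Definition cube_antipode_fun (t : cube_flag) : cube_flag :=
  ([ffun k => ~~ t.1 k], t.2).

Fact cube_R0K : involutive cube_R0.
Proof.
by case=> v s; congr (_, _); apply/ffunP=> k; rewrite !ffunE -addbA addbb addbF.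
Qed.
Fact cube_R1K : involutive cube_R1.
Proof. by case=> v s; rewrite /cube_R1 /= mulgA tperm2 mul1g. Qed.
Fact cube_R2K : involutive cube_R2.
Proof. by case=> v s; rewrite /cube_R2 /= mulgA tperm2 mul1g. Qed.
Fact cube_R02C t : cube_R0 (cube_R2 t) = cube_R2 (cube_R0 t).
Proof.
by case: t => v s; rewrite /cube_R0 /cube_R2 /= permM tpermD //;
  rewrite -val_eqE /= !inordK.
Qed.

Definition cube_map : gmap := mk_map cube_R0K cube_R1K cube_R2K cube_R02C.

Fact cube_antipodeK : involutive cube_antipode_fun.
Proof. by case=> v s; congr (_, _); apply/ffunP=> k; rewrite !ffunE negbK. Qed.

Definition cube_antipode : {perm cube_flag} := perm (inv_inj cube_antipodeK).

Fact cube_antipode_aut : <[cube_antipode]> \subset Aut_map cube_map.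
Proof.
apply: mk_map_aut => -[v s]; rewrite !permE //=.
by congr (_, _); apply/ffunP=> k; rewrite !ffunE addNb.
Qed.

Definition map_43_3 : gmap := @quotient_map cube_map <[cube_antipode]>%G cube_antipode_aut.

(* The 12 vertices are the cyclic shifts of (0, +-1, +-phi), phi being the golden
   ratio: ((i, s), t) has coordinate 0 on the axis i, +-1 on the axis i + 1 and
   +-phi on the axis i + 2 (modulo 3), where s and t are the signs.  Vertices are
   adjacent when their distance is 2, i.e. their scalar product is phi. *)
Definition ico_vertex : finType := ('Z_3 * bool * bool)%type.

Definition ico_adj (a b : ico_vertex) : bool :=
  let: (i, s, t) := a in let: (i', s', t') := b in
  [|| [&& i' == i, s' != s & t' == t],
      (i' == i + 1)%R && (s' == t) | (i == i' + 1)%R && (s == t')].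

(* The faces are the triangles of the graph: (a, b, c) is the flag formed by the
   vertex a, the edge ab and the face abc. *)
Definition ico_is_flag (t : (ico_vertex * ico_vertex * ico_vertex)%type) : bool :=
  let: (a, b, c) := t in [&& ico_adj a b, ico_adj a c & ico_adj b c].

Definition ico_flag : finType := {t | ico_is_flag t}.

(* The third vertex of the other face containing the edge ab of the face abc. *)
Definition ico_opp (a b c : ico_vertex) : ico_vertex :=
  odflt c [pick d | [&& d != c, ico_adj a d & ico_adj b d]].

Definition ico_neg (a : ico_vertex) : ico_vertex :=
  let: (i, s, t) := a in (i, ~~ s, ~~ t).

Definition ico_enum : seq ico_vertex :=
  [seq (p, t) | p <- [seq (i, s) | i <- [:: 0; 1; 2%:R]%R, s <- [:: true; false]],
                t <- [:: true; false]].

Fact mem_ico_enum a : a \in ico_enum.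
Proof. by case: a => [[[[|[|[|m]]] //= im] []] []]. Qed.

Fact ico_opp_check :
  all (fun a => all (fun b => all (fun c => if ico_is_flag (a, b, c) then
    size [seq d <- ico_enum | [&& d != c, ico_adj a d & ico_adj b d]] == 1%N
    else true) ico_enum) ico_enum) ico_enum.
Proof. by vm_compute. Qed.

Fact ico_adjC a b : ico_adj a b = ico_adj b a.
Proof.
case: a b => [[i s] t] [[i' s'] t'] /=.
rewrite (eq_sym i' i) (eq_sym s' s) (eq_sym t' t).
by congr orb; rewrite orbC.
Qed.

Fact ico_adj_neg a b : ico_adj (ico_neg a) (ico_neg b) = ico_adj a b.
Proof. by case: a b => [[i []] []] [[i' []] []]. Qed.

Fact ico_negK : involutive ico_neg.
Proof. by case=> [[i s] t] /=; rewrite !negbK. Qed.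

Fact ico_oppP a b c : ico_is_flag (a, b, c) ->
  [/\ ico_opp a b c != c, ico_adj a (ico_opp a b c), ico_adj b (ico_opp a b c) &
      forall d, d != c -> ico_adj a d -> ico_adj b d -> d = ico_opp a b c].
Proof.
move=> abc; have /allP/(_ a (mem_ico_enum a)) := ico_opp_check.
move=> /allP/(_ b (mem_ico_enum b))/allP/(_ c (mem_ico_enum c)).
rewrite abc; pose P d := [&& d != c, ico_adj a d & ico_adj b d].
rewrite -/P => sz1.
have P_opp d d' : P d -> P d' -> d = d'.
  move=> Pd Pd'; have: d \in filter P ico_enum by rewrite mem_filter Pd mem_ico_enum.
  have: d' \in filter P ico_enum by rewrite mem_filter Pd' mem_ico_enum.
  by case: (filter P _) sz1 => [|d0 []] // _; rewrite !inE => /eqP-> /eqP->.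
rewrite /ico_opp; case: pickP => [d Pd | P0] /=; last first.
  by move: sz1; rewrite (eq_filter P0) filter_pred0.
have /and3P[dc ad bd] := Pd; split=> // d' d'c ad' bd'.
by apply: P_opp => //; apply/and3P.
Qed.

Fact ico_R0_subproof a b c : ico_is_flag (a, b, c) -> ico_is_flag (b, a, c).
Proof. by rewrite /ico_is_flag (ico_adjC b a) => /and3P[-> -> ->]. Qed.
Fact ico_R1_subproof a b c : ico_is_flag (a, b, c) -> ico_is_flag (a, c, b).
Proof. by rewrite /ico_is_flag (ico_adjC c b) => /and3P[-> -> ->]. Qed.
Fact ico_R2_subproof a b c :
  ico_is_flag (a, b, c) -> ico_is_flag (a, b, ico_opp a b c).
Proof.
move=> abc; have [_ h1 h2 _] := ico_oppP abc.
by case/and3P: abc => ab _ _; rewrite /ico_is_flag ab h1 h2.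
Qed.
Fact ico_neg_subproof a b c :
  ico_is_flag (a, b, c) -> ico_is_flag (ico_neg a, ico_neg b, ico_neg c).
Proof. by rewrite /ico_is_flag !ico_adj_neg. Qed.

Definition ico_R0 (t : ico_flag) : ico_flag :=
  let: exist (a, b, c) abc := t in exist _ (b, a, c) (ico_R0_subproof abc).
Definition ico_R1 (t : ico_flag) : ico_flag :=
  let: exist (a, b, c) abc := t in exist _ (a, c, b) (ico_R1_subproof abc).
Definition ico_R2 (t : ico_flag) : ico_flag :=
  let: exist (a, b, c) abc := t in
  exist _ (a, b, ico_opp a b c) (ico_R2_subproof abc).
Definition ico_antipode_fun (t : ico_flag) : ico_flag :=
  let: exist (a, b, c) abc := t in
  exist _ (ico_neg a, ico_neg b, ico_neg c) (ico_neg_subproof abc).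

Fact ico_R0K : involutive ico_R0.
Proof. by case=> [[[a b] c] abc]; apply: val_inj. Qed.
Fact ico_R1K : involutive ico_R1.
Proof. by case=> [[[a b] c] abc]; apply: val_inj. Qed.
Fact ico_R2K : involutive ico_R2.
Proof.
case=> [[[a b] c] abc]; apply: val_inj => /=; congr (_, _, _).
have [oc _ _ _] := ico_oppP abc.
have [_ _ _ uniq] := ico_oppP (ico_R2_subproof abc).
by case/and3P: abc => _ ac bc; rewrite -(uniq c) // eq_sym.
Qed.
Fact ico_R02C t : ico_R0 (ico_R2 t) = ico_R2 (ico_R0 t).
Proof.
case: t => [[[a b] c] abc]; apply: val_inj => /=; congr (_, _, _).
have [oc ao bo _] := ico_oppP abc.
have [_ _ _ uniq] := ico_oppP (ico_R0_subproof abc).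
exact: uniq.
Qed.

Definition ico_map : gmap := mk_map ico_R0K ico_R1K ico_R2K ico_R02C.

Fact ico_antipodeK : involutive ico_antipode_fun.
Proof.
by case=> [[[a b] c] abc]; apply: val_inj => /=; rewrite !ico_negK.
Qed.

Definition ico_antipode : {perm ico_flag} := perm (inv_inj ico_antipodeK).

Fact ico_antipode_aut : <[ico_antipode]> \subset Aut_map ico_map.
Proof.
apply: mk_map_aut => -[[[a b] c] abc]; rewrite !permE; apply: val_inj => //=.
congr (_, _, _); have [oc ao bo _] := ico_oppP abc.
have [_ _ _ uniq] := ico_oppP (ico_neg_subproof abc).
by apply: uniq; rewrite ?ico_adj_neg // (inj_eq (inv_inj ico_negK)).
Qed.

Definition map_35_5 : gmap := @quotient_map ico_map <[ico_antipode]>%G ico_antipode_aut.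

Definition map_55_3 : gmap := petrie_dual map_35_5.

(* Main.v *)
Require Import Defs.
From mathcomp Require Import all_boot all_order all_algebra all_fingroup.
From mathcomp Require Import all_solvable all_field.
From HB Require Import structures.
From mathcomp Require Import vcharacter.
From mathcomp Require Import zify.

Set Implicit Arguments.
Unset Strict Implicit.
Unset Printing Implicit Defensive.

Import GroupScope GRing.Theory.

(** Let A be the automorphism group of an edge-transitive map M embedding K_n.
It acts freely on the flags.  For n >= 4 it also acts faithfully on the vertices:
an automorphism fixing every vertex acts on each flag trivially or as R_2, and
the latter reverses the cyclic order of the n - 1 >= 3 neighbours of a vertex.
As every pair of vertices spans an edge, A is 2-homogeneous on the vertices.
What it induces on the four flags of one edge separates the cases.

Suppose that no automorphism acts on an edge as R_2.  Then only the identity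
fixes two vertices, so A is a Frobenius group whose kernel K is regular on the
vertices.  All nontrivial elements of K are conjugate up to inversion, hence K is
a p-group equal to its centre.  The stabiliser of a vertex is a group of
rotations.  Indeed, a reflection in it would invert K, so there would be only one;
but a reflection exchanges two vertices and makes A transitive on arcs, so that
composing it with elements moving one arc to others gives further reflections.
Thus the stabiliser is abelian, and together with -1 it is a commutative group of
automorphisms of K transitive on its nonzero elements: K is the additive group of
a field F and A consists of affine maps ([homog_affine]).  Put a vertex at 0 and a
neighbour at 1.  If some automorphism rotates the neighbours of 0 by one step,
they are 1, c, c^2, ... in cyclic order, with c primitive.  Otherwise there is one
which rotates them by two steps, n is 3 modulo 4, and the even and the odd powers
of some c alternate ([rotary_map]).  The elements of A preserve the local
orientations translated from 0 to the other vertices and A is transitive on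
edges, so these orientations agree along all edges or along none: M is a Cayley
map or the Petrie dual of one ([cayley_iso]).

If some automorphism acts on an edge as R_2, it is an involution and exchanges two
vertices, so some automorphism reverses an edge and A is transitive on flags
([rotary_or_regular]).  For each u <> v at most two involutions take u to v.
Comparing the resulting bound on the number of involutions with the number of
their fixed vertices excludes odd n and leaves n <= 6 ([regular_not_odd],
[regular_even_le6]).  When n = 4, every permutation of the vertices comes from an
automorphism, and the even ones act as in the previous case ([regular_four]).
When n = 6, every involution fixes two vertices; hence M or its Petrie dual is a
triangulation, the automorphisms taking a flag to its neighbours are determined
as permutations of the vertices, and they lift to symmetries of the icosahedron
([regular_six]).

For n = 2 and n = 3 the map is built flag by flag.  The maps {6,2}_3 and {4,3}_3
are the Petrie duals of M_3(c) and M_4(c), and {5,5}_3 is that of {3,5}_5, so the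
Cayley maps and {3,5}_5 suffice up to Petrie duality. *)

(** * Fields from commuting additive maps *)

(** Multiplication by [a] is the scalar sending [one] to [a].  For a commuting
family of additive scalars, transitive on the nonzero elements, these are the laws
that can be read off directly; commutativity and associativity follow. *)
Record commuting_mul (T : finType) (add : T -> T -> T) (opp : T -> T)
    (zero one : T) (mul : T -> T -> T) : Prop := CommutingMul {
  cm_addA : associative add;
  cm_addC : commutative add;
  cm_add0 : left_id zero add;
  cm_addN : left_inverse zero opp add;
  cm_mulDr : right_distributive mul add;
  cm_mulr1 : right_id one mul;
  cm_mulCA : left_commutative mul;
  cm_integral : forall a b, mul a b = zero -> a = zero \/ b = zero;
  cm_one_neq0 : one != zero }.

Section FieldOfCommutingMul.

Variables (T : finType) (add : T -> T -> T) (opp : T -> T) (zero one : T).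
Variable mul : T -> T -> T.
Hypothesis cm : commuting_mul add opp zero one mul.

(** A copy of [T], so that the field structure does not interfere with other
structures on [T]. *)
Definition cm_carrier of commuting_mul add opp zero one mul : Type := T.
Local Notation F := (cm_carrier cm).

HB.instance Definition _ := Finite.copy F T.
HB.instance Definition _ := @GRing.isZmodule.Build F zero opp add
  (cm_addA cm) (cm_addC cm) (cm_add0 cm) (cm_addN cm).

(** [mul a b] is [mul a] applied to [mul b one], and the two scalars commute. *)
Fact cm_mulC : commutative mul.
Proof. by move=> a b; rewrite -{1}(cm_mulr1 cm b) (cm_mulCA cm) (cm_mulr1 cm). Qed.

Fact cm_mulA : associative mul.
Proof. by move=> a b c; rewrite (cm_mulC b c) (cm_mulCA cm) cm_mulC. Qed.

Fact cm_mul1 : left_id one mul.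
Proof. by move=> a; rewrite cm_mulC (cm_mulr1 cm). Qed.

Fact cm_mulDl : left_distributive mul add.
Proof. by move=> a b c; rewrite !(cm_mulC _ c) (cm_mulDr cm). Qed.

HB.instance Definition _ := @GRing.Zmodule_isComNzRing.Build F one mul
  cm_mulA cm_mulC cm_mul1 cm_mulDl (cm_one_neq0 cm).

Definition cm_inv (x : F) : F :=
  if x == 0%R then 0%R else odflt 0%R [pick y : F | (y * x == 1)%R].

Fact cm_mulVf (x : F) : x != 0%R -> (cm_inv x * x = 1)%R.
Proof.
move=> x0; rewrite /cm_inv (negPf x0); case: pickP => [y /eqP //|no] /=.
have injx : injective (fun y : F => (y * x)%R).
  move=> y z /eqP; rewrite -subr_eq0 -mulrBl => /eqP.
  move=> /(cm_integral cm)[e|e]; last by rewrite e eqxx in x0.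
  by apply/eqP; rewrite -subr_eq0; apply/eqP.
have [y e] := codomP (injF_onto injx (1%R : F)).
by have /eqP := no y; rewrite -e.
Qed.

Fact cm_inv0 : cm_inv 0%R = 0%R.
Proof. by rewrite /cm_inv eqxx. Qed.

HB.instance Definition _ := @GRing.ComNzRing_isField.Build F cm_inv cm_mulVf cm_inv0.

Lemma field_of_commuting_mul :
  exists (L : finFieldType) (f : T -> L),
    [/\ bijective f, {morph f : a b / add a b >-> (a + b)%R},
        {morph f : a b / mul a b >-> (a * b)%R}, f zero = 0%R & f one = 1%R].
Proof. by exists F, id; split=> //; exists id. Qed.

End FieldOfCommutingMul.

(** * Sharply 2-homogeneous permutation groups *)

Section SharplyTwoHomogeneous.

Variables (V : finType) (H : {group {perm V}}) (o : V).
Hypothesis V_gt3 : 3 < #|V|.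
Hypothesis homog : forall u v u' v' : V, u != v -> u' != v' ->
  exists2 h, h \in H & (h u = u' /\ h v = v') \/ (h u = v' /\ h v = u').
Hypothesis free : forall h u v, h \in H -> u != v -> h u = u -> h v = v -> h = 1.

Local Notation C := 'C_H[o | 'P].

Lemma avoid3 (a b c : V) : exists d, [/\ d != a, d != b & d != c].
Proof.
have : 0 < #|~: [set a; b; c]|.
  have := cardsC [set a; b; c]; have : #|[set a; b; c]| <= 3.
    by rewrite setUC cardsU1 cards2 -[3]/(1 + 2); case: (_ \notin _); case: (_ != _).
  by lia.
by case/card_gt0P=> d; rewrite !inE !negb_or -andbA => /and3P[]; exists d.
Qed.

Lemma stabP h : reflect (h \in H /\ h o = o) (h \in C).
Proof.
apply: (iffP setIP) => [[hH]|[hH ho]]; first by move/astab1P.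
by split=> //; apply/astab1P.
Qed.

(** Taking {u,w} to {v,w} either moves u to v, or moves u to w and w to v. *)
Lemma homog_transitive u v : exists2 h, h \in H & h u = v.
Proof.
have [->|uv] := eqVneq u v; first by exists 1; rewrite ?perm1.
have [w [wu wv _]] := avoid3 u v u; rewrite eq_sym in wu; rewrite eq_sym in wv.
have [h hH [[]|[hu hw]]] := homog wu wv; first by exists h.
by exists (h * h); rewrite ?groupM // permM hu.
Qed.

(** The stabiliser is nontrivial because the group would otherwise be regular:
elements taking {o,a} and {o,c} to {o,b} both move o to b, hence would coincide. *)
Lemma homog_Frobenius : [Frobenius H with complement C].
Proof.
apply/Frobenius_actionP; apply: (@hasFrobeniusAction _ H C V setT 'P); split.
- exact: aperm_faithful.
- apply/imsetP; exists o => //; apply/setP=> v; rewrite inE; symmetry; apply/orbitP.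
  by have [h hH hv] := homog_transitive o v; exists h.
- move=> h /setD1P[h1 hH]; rewrite leqNgt; apply: contra h1 => /card_gt1P[u [v []]].
  move=> /setIP[_ /afix1P fu] /setIP[_ /afix1P fv] uv; apply/eqP.
  exact: free hH uv fu fv.
- have [a [ao _ _]] := avoid3 o o o; have [b [bo ba _]] := avoid3 o a o.
  have [c [co ca cb]] := avoid3 o a b.
  rewrite eq_sym in ao; rewrite eq_sym in bo; rewrite eq_sym in co.
  apply/eqP=> C1; have stab1 h : h \in H -> h o = o -> h = 1.
    by move=> hH ho; apply/set1P; rewrite -[[set 1]]C1; apply/stabP.
  have swap x : o != x -> x != b -> exists2 h, h \in H & h o = b /\ h x = o.
    move=> ox xb; have [h hH [[h_o hx]|h_ox]] := homog ox bo; last by exists h.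
    by rewrite -hx (stab1 h) // perm1 eqxx in xb.
  have [g gH [go ga]] : exists2 h, h \in H & h o = b /\ h a = o.
    by apply: swap => //; rewrite eq_sym.
  have [g' g'H [g'o g'c]] : exists2 h, h \in H & h o = b /\ h c = o by apply: swap.
  have : g * g'^-1 = 1 by apply: stab1; rewrite ?groupM ?groupV // permM go -g'o permK.
  move/eqP; rewrite -eq_mulgV1 => /eqP eg; case/eqP: ca.
  by apply: (@perm_inj _ g); rewrite ga eg g'c.
- by exists o.
Qed.

(** The normal subgroup is the Frobenius kernel; comparing orders shows that it
is transitive. *)
Lemma homog_regular_normal : exists K : {group {perm V}},
  [/\ K <| H, forall k, k \in K -> k o = o -> k = 1 &
      forall u, exists2 k, k \in K & k o = u].
Proof.
have [K frobK] := Frobenius_kernel_exists homog_Frobenius.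
have [/sdprod_context[nKH sCH _ _ tiKC] _ _ _ _] := Frobenius_context frobK.
have regK k : k \in K -> k o = o -> k = 1.
  move=> kK ko; apply/set1P; rewrite -[[set 1]]tiKC inE kK; apply/stabP.
  by split=> //; apply: subsetP kK; apply: normal_sub.
exists K; split=> // u.
have injK : {in K &, injective (fun k : {perm V} => k o)}.
  move=> k k' kK k'K e; apply/eqP; rewrite eq_mulgV1; apply/eqP/regK.
    by rewrite groupM ?groupV.
  by rewrite permM e permK.
have cardK : #|K| = #|V|.
  have [defH _ _ _ _] := Frobenius_context frobK.
  have := sdprod_card defH; rewrite -(card_orbit_stab 'P H o).
  have -> : orbit 'P H o = [set: V].
    apply/setP=> v; rewrite inE; apply/orbitP.
    by have [h hH hv] := homog_transitive o v; exists h.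
  by rewrite cardsT => /eqP; rewrite eqn_pmul2r ?cardG_gt0 // => /eqP.
have : [set (fun k : {perm V} => k o) k | k in K] = [set: V].
  by apply/eqP; rewrite eqEcard subsetT cardsT card_in_imset // cardK leqnn.
by move/setP/(_ u); rewrite inE => /imsetP[k kK ->]; exists k.
Qed.

Section RegularNormal.

Variable K : {group {perm V}}.
Hypothesis nKH : K <| H.
Hypothesis regK : forall k, k \in K -> k o = o -> k = 1.
Hypothesis transK : forall u, exists2 k, k \in K & k o = u.

Lemma regular_inj k k' : k \in K -> k' \in K -> k o = k' o -> k = k'.
Proof.
move=> kK k'K e; apply/eqP; rewrite eq_mulgV1; apply/eqP/regK.
  by rewrite groupM ?groupV.
by rewrite permM e permK.
Qed.

Lemma stab_inv (h : {perm V}) : h o = o -> h^-1 o = o.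
Proof. by move=> ho; rewrite -{1}ho permK. Qed.

Lemma conj_stab (h k : {perm V}) : h o = o -> (k ^ h) o = h (k o).
Proof. by move=> ho; rewrite conjgE !permM stab_inv. Qed.

Lemma memJK (h k : {perm V}) : h \in H -> k \in K -> k ^ h \in K.
Proof. by move=> hH kK; rewrite memJ_norm // (subsetP (normal_norm nKH)). Qed.

(** Some element of H takes {o, k o} to {o, k' o}.  If it does not fix o, then
following it by the inverse of k' does, and turns k into that inverse. *)
Lemma regular_conj k k' : k \in K -> k' \in K -> k != 1 -> k' != 1 ->
  exists2 h, h \in H /\ h o = o & k ^ h = k' \/ k ^ h = k'^-1.
Proof.
have moves x : x \in K -> x != 1 -> o != x o.
  by move=> xK; apply: contraNneq => /esym/(regK xK)->.
move=> kK k'K k1 k'1; have sKH := subsetP (normal_sub nKH).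
have [g gH [[go gk]|[go gk]]] := homog (moves k kK k1) (moves k' k'K k'1).
  exists g => //; left; apply: regular_inj; rewrite ?memJK //.
  by rewrite conj_stab.
have ho : (g * k'^-1) o = o by rewrite permM go permK.
have hH : g * k'^-1 \in H by rewrite groupM ?groupV ?(sKH k').
exists (g * k'^-1); first by split.
right; apply: regular_inj; rewrite ?memJK ?groupV //.
by rewrite conj_stab // permM gk.
Qed.

(** By [regular_conj] all nontrivial elements have the same order p, so K is a
p-group; its centre is nontrivial, and contains every conjugate of its elements. *)
Lemma regular_abelian : abelian K.
Proof.
have [a [ao _ _]] := avoid3 o o o; have [z0 z0K z0o] := transK a.
have z01 : z0 != 1 by apply: contraNneq ao => e; rewrite -z0o e perm1.
have K1 : 1 < #|K|.
  by rewrite cardG_gt1; apply/trivgPn; exists z0.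
have [p p_pr pK] : exists2 p, prime p & p %| #|K|.
  by exists (pdiv #|K|); [rewrite pdiv_prime | rewrite pdiv_dvd].
have [x xK ox] := Cauchy p_pr pK.
have x1 : x != 1 by rewrite -order_gt1 ox prime_gt1.
have ordK y : y \in K -> y != 1 -> #[y] = p.
  move=> yK y1; have [h _ [e|e]] := regular_conj yK xK y1 x1.
    by rewrite -(orderJ _ h) e.
  by rewrite -(orderJ _ h) e orderV.
have pK' : p.-group K.
  apply/pgroupP=> q q_pr /(Cauchy q_pr)[y yK oy].
  by rewrite inE /= -oy ordK // -order_gt1 oy prime_gt1.
have ntZ : 'Z(K) != 1.
  rewrite center_nil_eq1 ?(pgroup_nil pK') //.
  by apply/trivgPn; exists z0.
have [z zZ z1] := trivgPn _ ntZ; have zK := subsetP (center_sub K) _ zZ.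
suffices : K \subset 'Z(K) by rewrite subsetI => /andP[].
apply/subsetP=> y yK; have [->|y1] := eqVneq y 1; first exact: group1.
have [h [hH _] zh] := regular_conj zK yK z1 y1.
have zhZ : z ^ h \in 'Z(K).
  rewrite memJ_norm // (subsetP _ _ hH) //.
  exact: char_norm_trans (center_char K) (normal_norm nKH).
by case: zh zhZ => ->; rewrite ?groupV.
Qed.

(** As K is abelian, k * k ^ h is fixed by h, but h commutes with no nontrivial
element of K. *)
Lemma stab_involution_inverts h k : h \in H -> h o = o -> h * h = 1 -> h != 1 ->
  k \in K -> k ^ h = k^-1.
Proof.
move=> hH ho hh h1 kK; have cKK := centsP regular_abelian.
have kh := memJK hH kK.
have fixh : (k * k ^ h) ^ h = k * k ^ h.
  by rewrite conjMg -conjgM hh conjg1; apply: cKK.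
have : k * k ^ h = 1.
  apply/eqP; apply: contraNT h1 => nt; apply/eqP.
  apply: (free hH (u := o) (v := (k * k ^ h) o)) => //.
    by apply: contraNneq nt => /esym/regK->; rewrite // groupM.
  by rewrite -(conj_stab (k * k ^ h) ho) fixh.
by move/eqP; rewrite -eq_invg_mul => /eqP.
Qed.

End RegularNormal.

(** The product of two of them centralises K, so it fixes two points. *)
Lemma stab_involution_unique h h' : h \in H -> h' \in H -> h o = o -> h' o = o ->
  h * h = 1 -> h' * h' = 1 -> h != 1 -> h' != 1 -> h = h'.
Proof.
move=> hH h'H ho h'o hh h'h' h1 h'1.
have [K [nKH regK transK]] := homog_regular_normal.
apply/eqP; rewrite eq_mulgV1; apply/eqP.
have [a [ao _ _]] := avoid3 o o o; have [k kK ka] := transK a.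
have inv := stab_involution_inverts nKH regK transK.
have gH : h * h'^-1 \in H by rewrite groupM ?groupV.
have go : (h * h'^-1) o = o by rewrite permM ho stab_inv.
rewrite eq_sym in ao; apply: (free gH ao) => //.
rewrite -ka -conj_stab // conjgM (inv h) //.
have h'V : h'^-1 = h' by apply/eqP; rewrite eq_invg_mul h'h'.
by rewrite h'V conjVg inv // invgK.
Qed.

End SharplyTwoHomogeneous.

Section AffineGroup.

Variables (V : finType) (H : {group {perm V}}) (o e : V).
Hypothesis V_gt3 : 3 < #|V|.
Hypothesis homog : forall u v u' v' : V, u != v -> u' != v' ->
  exists2 h, h \in H & (h u = u' /\ h v = v') \/ (h u = v' /\ h v = u').
Hypothesis free : forall h u v, h \in H -> u != v -> h u = u -> h v = v -> h = 1.
Hypothesis stab_comm : forall g h,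
  g \in H -> h \in H -> g o = o -> h o = o -> g * h = h * g.
Hypothesis eo : e != o.

(** Points are identified with elements of the regular normal subgroup by their
action on [o], which makes them an abelian group.  The stabiliser of [o] and -1
generate a commutative group of automorphisms, transitive on the nonzero points
because the group is 2-homogeneous; they serve as the scalars. *)
Theorem homog_affine : exists (F : finFieldType) (f : V -> F),
  [/\ bijective f, f o = 0%R /\ f e = 1%R,
      forall t : F, exists2 h, h \in H & forall u, f (h u) = (f u + t)%R,
      forall h, h \in H -> h o = o -> forall u, f (h u) = (f (h e) * f u)%R &
      forall x : F, x != 0%R -> exists2 h, h \in H /\ h o = o &
        f (h e) = x \/ f (h e) = (- x)%R].
Proof.
have [K [nKH regK transK]] := homog_regular_normal o V_gt3 homog free.
have cKK := centsP (regular_abelian V_gt3 homog nKH regK transK).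
have injK := regular_inj regK; have JK := memJK nKH.
pose tr u := odflt 1 [pick k in K | k o == u].
have trP u : tr u \in K /\ tr u o = u.
  rewrite /tr; case: pickP => [k /andP[kK /eqP ko] //|no].
  by have [k kK ko] := transK u; have := no k; rewrite kK ko eqxx.
have trK u : tr u \in K by case: (trP u).
have tro u : tr u o = u by case: (trP u).
have trE k : k \in K -> tr (k o) = k by move=> kK; apply: injK; rewrite ?tro.
pose add u w := (tr u * tr w) o.
have tr_add u w : tr (add u w) = tr u * tr w by rewrite trE ?groupM.
pose opp u := (tr u)^-1 o.
have tr_opp u : tr (opp u) = (tr u)^-1 by rewrite trE ?groupV.
have tr_inj u w : tr u = tr w -> u = w by move=> euw; rewrite -(tro u) euw tro.
have tr_o : tr o = 1 by rewrite -{1}[o](perm1 o) trE.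
have addC : commutative add by move=> u w; apply: tr_inj; rewrite !tr_add cKK.
have addA : associative add.
  by move=> u v w; apply: tr_inj; rewrite !tr_add mulgA.
have add0 : left_id o add by move=> u; apply: tr_inj; rewrite tr_add tr_o mul1g.
have addN : left_inverse o opp add.
  by move=> u; apply: tr_inj; rewrite tr_add tr_opp tr_o mulVg.
(* [sg s] is multiplication by -1 when s holds.  The maps sg s o h with h in the
   stabiliser are the scalars. *)
pose sg (s : bool) u := if s then opp u else u.
have sgD s : {morph sg s : u w / add u w}.
  case: s => // u w; apply: tr_inj; rewrite /= tr_opp !tr_add !tr_opp invMg.
  by rewrite cKK ?groupV.
pose inC h := (h \in H) && (h o == o).
have trJ h u : inC h -> tr (h u) = tr u ^ h.
  case/andP=> hH /eqP ho; apply: injK; rewrite ?JK // tro.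
  by rewrite conj_stab // tro.
have hD h : inC h -> {morph h : u w / add u w}.
  by move=> hC u w; apply: tr_inj; rewrite trJ // !tr_add conjMg -!trJ.
have hsg h s u : inC h -> h (sg s u) = sg s (h u).
  by case: s => // hC; apply: tr_inj; rewrite trJ // /= !tr_opp conjVg -trJ.
have sgsg s s' u : sg s (sg s' u) = sg s' (sg s u) by case: s; case: s'.
have sgo s : sg s o = o by case: s => //; apply: tr_inj; rewrite tr_opp tr_o invg1.
have sg_inj s : injective (sg s).
  case: s => // u w /(congr1 tr); rewrite /= !tr_opp => /invg_inj.
  exact: tr_inj.
have signed_trans a : a != o -> exists h s, inC h && (sg s (h e) == a).
  move=> ao; rewrite eq_sym in ao; have oe : o != e by rewrite eq_sym.
  have tr1 u : o != u -> tr u != 1.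
    by apply: contraNneq => tu; rewrite -(tro u) tu perm1.
  have [h [hH ho] hk] := regular_conj homog nKH regK (trK e) (trK a) (tr1 e oe) (tr1 a ao).
  have hC : inC h by rewrite /inC hH ho eqxx.
  case: hk; rewrite -trJ // => hk.
    by exists h, false; rewrite hC /= -(tro a) -hk tro eqxx.
  exists h, true; rewrite hC /=; apply/eqP/tr_inj.
  by rewrite tr_opp hk invgK.
pose sc a := odflt (1, false)
  [pick hs : {perm V} * bool | inC hs.1 && (sg hs.2 (hs.1 e) == a)].
have scP a : inC (sc a).1 /\ (a != o -> sg (sc a).2 ((sc a).1 e) = a).
  rewrite /sc; case: pickP => [[h s] /= /andP[-> /eqP] //|no] /=.
  split=> [|/signed_trans[h [s hs]]]; first by rewrite /inC group1 perm1 eqxx.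
  by have := no (h, s); rewrite hs.
pose mul a b := if a == o then o else sg (sc a).2 ((sc a).1 b).
have scC a : inC (sc a).1 by case: (scP a).
have sce a : a != o -> sg (sc a).2 ((sc a).1 e) = a by case: (scP a).
have inCo h : inC h -> h o = o by case/andP=> _ /eqP.
have mulo a : mul a o = o by rewrite /mul; case: eqP => // _; rewrite inCo ?sgo.
have hmul h a b : inC h -> h (mul a b) = mul a (h b).
  move=> hC; rewrite /mul; case: eqP => _; first exact: inCo.
  rewrite hsg //; congr (sg _ _); rewrite -!permM; congr (fun_of_perm _ b).
  have /andP[gH /eqP go] := scC a; have /andP[hH /eqP ho] := hC.
  exact: stab_comm.
have smul s a b : sg s (mul a b) = mul a (sg s b).
  rewrite /mul; case: eqP => _; first exact: sgo.
  by rewrite sgsg hsg.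
have cm : commuting_mul add opp o e mul.
  split=> //.
  - move=> a b c; rewrite /mul; case: eqP => _; first by rewrite add0.
    by rewrite hD ?sgD.
  - move=> a; rewrite /mul; case: eqP => [->|/eqP/sce] //.
  - move=> a b c; rewrite {1 4}/mul; case: eqP => _; first by rewrite mulo.
    by rewrite hmul // smul.
  - move=> a b; rewrite /mul; case: eqP => [->|_ eo']; first by left.
    right; apply: (@perm_inj _ (sc a).1); apply: (@sg_inj (sc a).2).
    by rewrite eo' inCo ?sgo.
have [F [f [fbij fD fM fo fe]]] := field_of_commuting_mul cm.
have fN u : f (opp u) = (- f u)%R.
  by apply/eqP; rewrite -addr_eq0 -fD addN fo.
exists F, f; split=> //.
- move=> t; have [f' fK f'K] := fbij; exists (tr (f' t)).
    by rewrite (subsetP (normal_sub nKH)).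
  by move=> u; rewrite -{1}(tro u) -permM -/(add _ _) fD f'K.
- move=> h hH ho u; have hC : inC h by rewrite /inC hH ho eqxx.
  by rewrite -{1}(cm_mulr1 cm u) hmul // fM mulrC.
move=> x x0; have [f' fK f'K] := fbij.
have fx : f' x != o by apply: contra_neq x0 => fx; rewrite -(f'K x) fx fo.
have [h [s /andP[/andP[hH /eqP ho] /eqP hs]]] := signed_trans _ fx.
exists h => //; case: s hs => /= hs; [right | left].
  by rewrite -(f'K x) -hs fN opprK.
by rewrite hs f'K.
Qed.

End AffineGroup.

(** * Flags, edges and automorphisms *)

Section Words.

Variables (T : finType) (A : {set {perm T}}).

Lemma gen_orbit_ind (P : T -> Prop) x y :
    (forall a z, a \in A -> P z -> P (a z)) -> P x -> y \in orbit 'P <<A>> x -> P y.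
Proof.
move=> PA Px /orbitP[g /gen_prodgP[n [c cA ->]] <-]; rewrite /= apermE.
elim: n c cA => [|n IH] c cA; first by rewrite big_ord0 perm1.
by rewrite big_ord_recr permM; apply: PA; last apply: IH.
Qed.

End Words.

Section Basics.

Variable M : gmap.
Local Notation r0 := (R_0 M).
Local Notation r1 := (R_1 M).
Local Notation r2 := (R_2 M).

Lemma R0K : involutive r0.
Proof. by move=> x; rewrite -permM -[_ * _]/(r0 ^+ 2) R_0_sq perm1. Qed.
Lemma R1K : involutive r1.
Proof. by move=> x; rewrite -permM -[_ * _]/(r1 ^+ 2) R_1_sq perm1. Qed.
Lemma R2K : involutive r2.
Proof. by move=> x; rewrite -permM -[_ * _]/(r2 ^+ 2) R_2_sq perm1. Qed.

Lemma R02C x : r0 (r2 x) = r2 (r0 x).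
Proof.
have := R_02_sq M => /permP/(_ (r0 (r2 x))).
by rewrite expgS expg1 !permM perm1 R0K R2K => ->.
Qed.

Lemma Aut_mapP (a : {perm flag M}) :
  reflect [/\ forall x, a (r0 x) = r0 (a x), forall x, a (r1 x) = r1 (a x)
            & forall x, a (r2 x) = r2 (a x)] (a \in Aut_map M).
Proof.
rewrite /= cent_gen; apply: (iffP centP) => [ca|[a0 a1 a2] r].
  by split=> x; rewrite -!permM ca // !inE eqxx ?orbT.
by rewrite !inE -orbA => /or3P[] /eqP->; apply/permP=> x; rewrite !permM.
Qed.

Hypothesis conn : connected M.

(** Connectedness, as an induction principle. *)
Lemma flag_ind (P : flag M -> Prop) x :
    (forall z, P z -> P (r0 z)) -> (forall z, P z -> P (r1 z)) ->
    (forall z, P z -> P (r2 z)) -> P x -> forall y, P y.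
Proof.
move=> P0 P1 P2 Px y; have : y \in orbit 'P <<[set r0; r1; r2]>> x by rewrite (atransP conn) // inE.
apply: gen_orbit_ind Px => a z; rewrite !inE -orbA.
by case/or3P=> /eqP->; auto.
Qed.

(** The set where two automorphisms agree is closed under R_0, R_1 and R_2. *)
Lemma Aut_free a b x : a \in Aut_map M -> b \in Aut_map M -> a x = b x -> a = b.
Proof.
move=> /Aut_mapP[a0 a1 a2] /Aut_mapP[b0 b1 b2] ab; apply/permP.
by apply: (@flag_ind _ x) => // z e; rewrite (a0, a1, a2) (b0, b1, b2) e.
Qed.

Lemma edge_orbitP x y : reflect [\/ y = x, y = r2 x, y = r0 x | y = r0 (r2 x)]
  (y \in orbit 'P <<[set r0; r2]>> x).
Proof.
apply: (iffP idP) => [yE|E].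
  pose P z := [\/ z = x, z = r2 x, z = r0 x | z = r0 (r2 x)].
  apply: (gen_orbit_ind (P := P)) yE; last by constructor 1.
  rewrite /P => a z; rewrite !inE => /orP[] /eqP->.
    by case=> ->; rewrite ?R0K; [constructor 3|constructor 4|constructor 1|constructor 2].
  case=> ->; rewrite -?R02C ?R2K; [constructor 2|constructor 1|constructor 4|constructor 3] => //.
have m0 : r0 \in <<[set r0; r2]>> by rewrite mem_gen // !inE eqxx.
have m2 : r2 \in <<[set r0; r2]>> by rewrite mem_gen // !inE eqxx orbT.
case: E => ->; apply/orbitP; first by exists 1; rewrite // /= apermE perm1.
- by exists r2.
- by exists r0.
by exists (r2 * r0); rewrite ?groupM //= apermE permM.
Qed.

Lemma edge_transP : edge_transitive M -> forall x y, exists2 a, a \in Aut_map M &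
  [\/ a x = y, a x = r2 y, a x = r0 y | a x = r0 (r2 y)].
Proof.
move=> et x y; pose E z := orbit 'P <<[set r0; r2]>> z.
have Eedge z : E z \in edges M by apply/imsetP; exists z.
have [a aA e] := atransP2 et (Eedge x) (Eedge y); exists a => //.
apply/edge_orbitP; rewrite -/(E y) e /= /setact; apply/imsetP; exists x => //.
exact: orbit_refl.
Qed.

End Basics.

(** * Flags labelled by vertices *)

(** The form in which an embedding of a complete graph is used: the two vertices
of an arc determine its flag up to R_2.  The names may later be replaced by
elements of a field. *)
Record labelling (M : gmap) (V : finType) (l : flag M -> V) : Prop := Labelling {
  lab1 : forall x, l (R_1 M x) = l x;
  lab2 : forall x, l (R_2 M x) = l x;
  lab_orbit : forall x y, l x = l y -> y \in orbit 'P <<[set R_1 M; R_2 M]>> x;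
  lab0 : forall x, l (R_0 M x) != l x;
  lab_arc : forall x y, l x = l y -> l (R_0 M x) = l (R_0 M y) ->
    y = x \/ y = R_2 M x;
  lab_complete : forall u v, u != v -> exists2 x, l x = u & l (R_0 M x) = v }.

Lemma embeds_labelling M n : embeds M (complete_graph n) ->
  exists l : flag M -> 'I_n, labelling l.
Proof.
case=> f [f_inj fV inj_ends endsE].
pose O x := orbit 'P <<[set R_1 M; R_2 M]>> x.
pose E x := orbit 'P <<[set R_0 M; R_2 M]>> x.
have OV x : O x \in vertices M by apply/imsetP; exists x.
have EE x : E x \in edges M by apply/imsetP; exists x.
have Oeq x y : (O x == O y) = (y \in O x) by rewrite eq_sym orbit_eq_mem.
have Orefl x : x \in O x by apply: orbit_refl.
have Odisj x y z : z \in O x -> z \in O y -> O x = O y.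
  by rewrite -!Oeq => /eqP-> /eqP->.
have /fin_all_exists[l lP] x : exists u, f u = O x.
  by have := OV x; rewrite -fV => /imsetP[u _ ->]; exists u.
have lE x y : l x = l y <-> y \in O x.
  by rewrite -Oeq -!lP; split=> [->//|/eqP/f_inj].
have O1 x : R_1 M x \in O x by apply: mem_orbit; rewrite mem_gen // !inE eqxx.
have O2 x : R_2 M x \in O x by apply: mem_orbit; rewrite mem_gen // !inE eqxx orbT.
have l1 x : l (R_1 M x) = l x by symmetry; apply/lE.
have l2 x : l (R_2 M x) = l x by symmetry; apply/lE.
have E0 x : R_0 M x \in E x by apply: mem_orbit; rewrite mem_gen // !inE eqxx.
have endE x : ends (E x) = [set f (l x); f (l (R_0 M x))].
  apply/setP=> X; rewrite !inE; apply/andP/orP.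
    case=> /imsetP[y _ ->] /set0Pn[z] /setIP[]; rewrite -/(O y) => zy zx.
    have -> : O y = f (l z) by rewrite lP; apply: Odisj zy (Orefl z).
    by case/edge_orbitP: zx => ->; rewrite ?R02C ?l2 eqxx; auto.
  case=> /eqP->; rewrite lP OV; split=> //; apply/set0Pn.
    by exists x; rewrite inE Orefl orbit_refl.
  by exists (R_0 M x); rewrite inE Orefl E0.
have ends_simple x : exists u v, u != v /\ [set f (l x); f (l (R_0 M x))] = [set f u; f v].
  have : ends (E x) \in ends (M:=M) @: edges M by apply: imset_f.
  rewrite endsE endE => /imset2P[u v _]; rewrite inE => /andP[_ uv] ->.
  by exists u, v.
have l0 x : l (R_0 M x) != l x.
  have [u [v [uv e]]] := ends_simple x; apply: contra uv => /eqP e0.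
  have := cards2 (f u) (f v); rewrite -e e0 setUid cards1.
  by rewrite (inj_eq f_inj); case: eqVneq.
exists l; split=> //.
- by move=> x y /lE.
- move=> x y e e0; have ee : E x = E y by apply: inj_ends => //; rewrite !endE e e0.
  have := orbit_refl 'P <<[set R_0 M; R_2 M]>> y; rewrite -/(E y) -ee => /edge_orbitP[].
  + by left.
  + by right.
  + by move=> ye; have := l0 x; rewrite -ye e eqxx.
  by move=> ye; have := l0 x; rewrite -l2 -R02C -ye e eqxx.
move=> u v uv; have : [set f u; f v] \in ends (M:=M) @: edges M.
  by rewrite endsE; apply/imset2P; exists u v; rewrite ?inE //=.
case/imsetP=> _ /imsetP[x _ ->]; rewrite -/(E x) endE => e.
have : f u \in [set f (l x); f (l (R_0 M x))] by rewrite -e !inE eqxx.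
have : f v \in [set f (l x); f (l (R_0 M x))] by rewrite -e !inE eqxx orbT.
rewrite !inE !(inj_eq f_inj).
case/orP=> /eqP ev /orP[] /eqP eu; rewrite ?eu ?ev ?eqxx in uv * => //.
  by exists (R_0 M x); rewrite ?R0K.
by exists x.
Qed.

(** * The rotation around a vertex *)

Section Rotation.

Variables (M : gmap) (V : finType) (l : flag M -> V).
Hypotheses (lab : labelling l) (conn : connected M) (bd : boundaryless M).

Local Notation r0 := (R_0 M).
Local Notation r1 := (R_1 M).
Local Notation r2 := (R_2 M).

Definition rho : {perm flag M} := r1 * r2.

Lemma rhoE x : rho x = r2 (r1 x). Proof. exact: permM. Qed.

Lemma lab_rho i x : l ((rho ^+ i) x) = l x.
Proof.
elim: i x => [|i IH] x; first by rewrite perm1.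
by rewrite expgS permM IH rhoE (lab2 lab) (lab1 lab).
Qed.

Lemma rhoX_add i j x : (rho ^+ (i + j)) x = (rho ^+ j) ((rho ^+ i) x).
Proof. by rewrite expgD permM. Qed.

Lemma rhoS i x : (rho ^+ i.+1) x = (rho ^+ i) (rho x).
Proof. by rewrite -add1n rhoX_add expg1. Qed.

Lemma rhoSr i x : (rho ^+ i.+1) x = rho ((rho ^+ i) x).
Proof. by rewrite -addn1 rhoX_add expg1. Qed.

(** R_2 conjugates the rotation to its inverse. *)
Lemma rho_r2 i x : (rho ^+ i) (r2 ((rho ^+ i) x)) = r2 x.
Proof.
elim: i x => [|i IH] x; first by rewrite !perm1.
by rewrite [LHS]rhoS rhoSr rhoE rhoE R2K R1K IH.
Qed.

(** R_2 followed by a power of the rotation is conjugate to R_1 or R_2, neither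
of which fixes a flag when there is no boundary. *)
Lemma r2_rho_neq i x : r2 ((rho ^+ i) x) <> x.
Proof.
elim/ltn_ind: i x => -[|[|i]] IH x e.
- by have [_ _ /eqP] := bd x; rewrite -{2}e perm1.
- by have [_ /eqP] := bd x; rewrite expg1 rhoE R2K in e.
apply: (IH i _ (rho x)) => //; rewrite -[in RHS]e.
rewrite rhoS rhoSr.
by have := rho_r2 1 ((rho ^+ i) (rho x)); rewrite expg1.
Qed.

Lemma star_cases x y : l x = l y ->
  exists i, y = (rho ^+ i) x \/ y = r2 ((rho ^+ i) x).
Proof.
pose P y := exists i, y = (rho ^+ i) x \/ y = r2 ((rho ^+ i) x).
have rhoV z : rho^-1 z = r1 (r2 z).
  by apply: (@perm_inj _ rho); rewrite permKV rhoE R1K R2K.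
move/(lab_orbit lab); apply: (gen_orbit_ind (P := P)); last first.
  by exists 0%N; left; rewrite perm1.
move=> a z aA [i iz]; have [j jz] : exists j, r1 z = r2 ((rho ^+ j) x) \/ r1 z = (rho ^+ j) x.
  case: iz => ->; first by exists i.+1; left; rewrite rhoSr rhoE R2K.
  exists (i + #[rho].-1)%N; right; rewrite rhoX_add -rhoV.
  by congr (fun_of_perm _ _); rewrite invg_expg.
move: aA; rewrite !inE => /orP[] /eqP->; first by exists j; tauto.
by exists i; case: iz => ->; rewrite ?R2K; auto.
Qed.

(** The flags at a vertex fall into two orbits of the rotation, exchanged by R_2:
the two local orientations. *)
Lemma star_disjoint i j x : (rho ^+ j) x <> r2 ((rho ^+ i) x).
Proof.
move=> e; apply: (@r2_rho_neq (i * #[rho].-1 + j) ((rho ^+ i) x)).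
rewrite -rhoX_add addnA -mulnS prednK // mulnC rhoX_add expgM expg_order expg1n perm1.
by rewrite e R2K.
Qed.

(** The neighbours of [l x] in cyclic order, in the local orientation of [x]. *)
Definition nbr x i : V := l (r0 ((rho ^+ i) x)).

Lemma nbr_inj x i j : nbr x i = nbr x j -> (rho ^+ i) x = (rho ^+ j) x.
Proof.
move=> e; have eij : l ((rho ^+ j) x) = l ((rho ^+ i) x) by rewrite !lab_rho.
have [//|e2] := lab_arc lab eij (esym e).
by case: (@star_disjoint j i x).
Qed.

Lemma nbr_neq x i : nbr x i != l x.
Proof. by rewrite /nbr -(lab_rho i x) (lab0 lab). Qed.

Lemma nbr_surj x v : v != l x -> exists i, nbr x i = v.
Proof.
rewrite eq_sym => /(lab_complete lab)[y ly <-].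
have [i [->|->]] := star_cases (esym ly); exists i => //.
by rewrite /nbr R02C (lab2 lab).
Qed.

(** The flags of one rotation orbit correspond to the neighbours of its
vertex. *)
Lemma card_star x : #|porbit rho x| = #|V|.-1.
Proof.
have <- : #|[set v | v != l x]| = #|V|.-1.
  by rewrite -(cardsC1 (l x)); apply: eq_card => v; rewrite !inE.
have inj : {in porbit rho x &, injective (fun y => l (r0 y))}.
  by move=> y z /porbitP[i ->] /porbitP[j ->]; apply: nbr_inj.
rewrite -(card_in_imset inj); apply: eq_card => v; rewrite inE.
apply/imsetP/idP => [[y /porbitP[i ->] ->]|/nbr_surj[i <-]]; first exact: nbr_neq.
by exists ((rho ^+ i) x); rewrite // mem_porbit.
Qed.

Lemma rho_period x : (rho ^+ #|V|.-1) x = x.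
Proof. by rewrite permX -(card_star x) iter_porbit. Qed.

Lemma rho_mod i x : (rho ^+ (i %% #|V|.-1)) x = (rho ^+ i) x.
Proof.
rewrite {2}(divn_eq i #|V|.-1) addnC rhoX_add.
elim: (i %/ _) => [|q IH]; first by rewrite mul0n perm1.
by rewrite mulSn rhoX_add rho_period.
Qed.

Lemma rho_eq_mod i j x : (rho ^+ i) x = (rho ^+ j) x -> i = j %[mod #|V|.-1].
Proof.
rewrite -(rho_mod i) -(rho_mod j) !permX.
have n0 : 0 < #|V|.-1 by rewrite -(card_star x) lt0n card_porbit_neq0.
have szn : size (traject rho x #|V|.-1) = #|V|.-1 by rewrite size_traject.
rewrite -(nth_traject rho (ltn_pmod i n0)) -(nth_traject rho (ltn_pmod j n0)) => /eqP.
rewrite nth_uniq ?szn ?ltn_pmod // => [/eqP //|].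
by rewrite -(card_star x) uniq_traject_porbit.
Qed.

Lemma nbr_eq_mod x i j : nbr x i = nbr x j <-> i = j %[mod #|V|.-1].
Proof.
split=> [/nbr_inj/rho_eq_mod //|e].
by rewrite /nbr -(rho_mod i) e rho_mod.
Qed.

End Rotation.

(** * Automorphisms acting on the vertices *)

Section VertexAction.

Variables (M : gmap) (V : finType) (l : flag M -> V).
Hypotheses (lab : labelling l) (conn : connected M) (bd : boundaryless M).

Local Notation r0 := (R_0 M).
Local Notation r1 := (R_1 M).
Local Notation r2 := (R_2 M).
Local Notation rho := (rho M).

Definition lifts (a : {perm flag M}) (s : {perm V}) : bool :=
  (a \in Aut_map M) && [forall x, l (a x) == s (l x)].

Lemma liftsP a (s : {perm V}) :
  reflect (a \in Aut_map M /\ forall x, l (a x) = s (l x)) (lifts a s).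
Proof.
apply: (iffP andP) => [[aA /forallP h]|[aA h]]; split=> //; first by move=> x; apply/eqP.
by apply/forallP=> x; apply/eqP.
Qed.

Lemma aut_rho a i x : a \in Aut_map M -> a ((rho ^+ i) x) = (rho ^+ i) (a x).
Proof.
case/Aut_mapP=> _ a1 a2; elim: i x => [|i IH] x; first by rewrite !perm1.
by rewrite !rhoS IH !rhoE a2 a1.
Qed.

Lemma lifts1 : lifts 1 1.
Proof. by apply/liftsP; split=> [|x]; rewrite ?group1 // !perm1. Qed.

Lemma liftsM a b s t : lifts a s -> lifts b t -> lifts (a * b) (s * t).
Proof.
move=> /liftsP[aA a_s] /liftsP[bA b_t]; apply/liftsP; split=> [|x].
  by rewrite groupM.
by rewrite !permM b_t a_s.
Qed.

Lemma liftsV a s : lifts a s -> lifts a^-1 s^-1.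
Proof.
move=> /liftsP[aA a_s]; apply/liftsP; split=> [|x]; first by rewrite groupV.
by apply: (@perm_inj _ s); rewrite -a_s !permKV.
Qed.

Lemma lifts_nbr a (s : {perm V}) x i : lifts a s -> s (nbr l x i) = nbr l (a x) i.
Proof.
case/liftsP=> aA a_s; rewrite /nbr -a_s -aut_rho //.
by have /Aut_mapP[-> _ _] := aA.
Qed.

Hypothesis V_gt1 : 1 < #|V|.

Lemma lab_surj u : exists x, l x = u.
Proof.
have : 0 < #|predC1 u| by rewrite cardC1 -subn1 subn_gt0.
case/card_gt0P=> v; rewrite inE /= eq_sym => /(lab_complete lab)[x lx _].
by exists x.
Qed.

Lemma aut_lifts a : a \in Aut_map M -> exists s, lifts a s.
Proof.
move=> aA; have /fin_all_exists[g gP] : forall u, exists x, l x = u := lab_surj.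
have commute_star x y : l x = l y -> l (a x) = l (a y).
  have /Aut_mapP[_ _ a2] := aA.
  move=> /(star_cases lab)[i [->|->]]; rewrite ?a2 ?(lab2 lab) aut_rho // lab_rho //.
have s_inj : injective (fun u => l (a (g u))).
  move=> u v /(star_cases lab)[i e].
  have /Aut_mapP[_ _ a2] := aA; rewrite -(gP u) -(gP v).
  by case: e; rewrite -aut_rho // -?a2 => /perm_inj->; rewrite ?(lab2 lab) lab_rho.
exists (perm s_inj); apply/liftsP; split=> // x.
by rewrite permE; apply: commute_star; rewrite gP.
Qed.

Lemma lifts_uniq a s t : lifts a s -> lifts a t -> s = t.
Proof.
move=> /liftsP[_ a_s] /liftsP[_ a_t]; apply/permP=> u.
by have [x <-] := lab_surj u; rewrite -a_s a_t.
Qed.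

Definition vertex_group_set := [set s | [exists a, lifts a s]].

Lemma vertex_groupP s : reflect (exists a, lifts a s) (s \in vertex_group_set).
Proof. by rewrite inE; apply: existsP. Qed.

Fact vertex_group_set_group : group_set vertex_group_set.
Proof.
apply/group_setP; split; first by apply/vertex_groupP; exists 1; apply: lifts1.
move=> s t /vertex_groupP[a a_s] /vertex_groupP[b b_t].
by apply/vertex_groupP; exists (a * b); apply: liftsM.
Qed.

Definition vertex_group : {group {perm V}} := Group vertex_group_set_group.

Hypothesis V_gt3 : 3 < #|V|.

(** Otherwise the automorphism acts as R_2 on some flag, and then also on the next
one; this makes the square of the rotation trivial, contrary to the degree being
at least 3. *)
Lemma lifts_faithful a : lifts a 1 -> a = 1.
Proof.
case/liftsP=> aA a1; have /card_gt0P[u _] := ltnW V_gt1.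
have [x _] := lab_surj u.
have [a0 _ a2] := Aut_mapP _ aA.
have fix_arc y : a y = y \/ a y = r2 y.
  by apply: (lab_arc lab); rewrite -?a0 a1 perm1.
apply: (@Aut_free _ conn _ _ x) => //; rewrite perm1.
have [//|ax] := fix_arc x; have := fix_arc (rho x).
rewrite -[rho]expg1 aut_rho // ax => -[/perm_inj e|e].
  by have [_ _ /eqP[]] := bd x.
have := @rho_r2 M 1 x; rewrite -e -rhoX_add -[RHS](perm1 (r2 x)).
by move/(@rho_eq_mod _ _ _ lab bd 2 0); rewrite mod0n modn_small //; lia.
Qed.

Lemma lifts_inj a b s : lifts a s -> lifts b s -> a = b.
Proof.
move=> a_s b_s; apply/eqP; rewrite eq_mulgV1; apply/eqP/lifts_faithful.
by rewrite -(mulgV s); apply: liftsM => //; apply: liftsV.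
Qed.

End VertexAction.

(** * Isomorphism and Petrie duality *)

Lemma inj_surj_bij (T T' : finType) (f : T -> T') :
  injective f -> (forall y, exists x, f x = y) -> bijective f.
Proof.
move=> f_inj f_surj; apply: inj_card_bij => //.
have /fin_all_exists[g gP] := f_surj; apply: (@leq_card _ _ g) => y z e.
by rewrite -(gP y) e gP.
Qed.

Lemma map_iso_sym M N : map_iso M N -> map_iso N M.
Proof.
case=> f [[g fK gK] f0 f1 f2]; exists g; split; first by exists f.
- by move=> x; rewrite -{1}(gK x) -f0 fK.
- by move=> x; rewrite -{1}(gK x) -f1 fK.
by move=> x; rewrite -{1}(gK x) -f2 fK.
Qed.

Lemma map_iso_petrie M N : map_iso M N -> map_iso (petrie_dual M) (petrie_dual N).
Proof.
by case=> f [bf f0 f1 f2]; exists f; split=> // x; rewrite /= !permM f2 f0.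
Qed.

Lemma petrie_dualK M : map_iso (petrie_dual (petrie_dual M)) M.
Proof.
exists id; split=> //=; first by exists id.
by move=> x; rewrite !permM R2K.
Qed.

Lemma map_iso_trans M N P : map_iso M N -> map_iso N P -> map_iso M P.
Proof.
case=> f [bf f0 f1 f2] [g [bg g0 g1 g2]]; exists (g \o f); split.
- exact: bij_comp.
- by move=> x /=; rewrite f0 g0.
- by move=> x /=; rewrite f1 g1.
by move=> x /=; rewrite f2 g2.
Qed.

Section PetrieDual.

Variables (M : gmap) (V : finType) (l : flag M -> V).
Hypothesis lab : labelling l.

Lemma petrie_monodromy : monodromy (petrie_dual M) = monodromy M.
Proof.
have gens (r s t : {perm flag M}) :
    [/\ r \in <<[set r; s; t]>>, s \in <<[set r; s; t]>> & t \in <<[set r; s; t]>>].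
  by split; rewrite mem_gen // !inE eqxx ?orbT.
have [m0 m1 m2] := gens (R_0 M) (R_1 M) (R_2 M).
have [p0 p1 p2] := gens (R_0 M * R_2 M) (R_1 M) (R_2 M).
apply/val_inj/eqP; rewrite /= eqEsubset !gen_subG.
apply/andP; split; apply/subsetP=> r; rewrite !inE -orbA => /or3P[] /eqP-> //.
  by rewrite groupM.
by have := groupM p0 (groupVr p2); rewrite mulgK.
Qed.

Lemma petrie_connected : connected M -> connected (petrie_dual M).
Proof. by rewrite /connected petrie_monodromy. Qed.

Lemma petrie_Aut : Aut_map (petrie_dual M) = Aut_map M.
Proof. by rewrite /Aut_map petrie_monodromy. Qed.

Lemma petrie_boundaryless : boundaryless M -> boundaryless (petrie_dual M).
Proof.
move=> bd x; have [_ b1 b2] := bd x; split=> //=.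
by apply: contraTneq (lab0 lab x) => e; rewrite negbK -{2}e permM (lab2 lab).
Qed.

Lemma petrie_labelling : @labelling (petrie_dual M) V l.
Proof.
have [l1 l2 lO l0 lA lC] := lab; split=> //= [x|x y e|u v uv].
- by rewrite permM l2.
- by rewrite !permM !l2; apply: lA.
by have [x lx lx0] := lC u v uv; exists x; rewrite ?permM ?l2.
Qed.

End PetrieDual.

Lemma iso_petrie_dual M N : map_iso (petrie_dual M) N -> map_iso M (petrie_dual N).
Proof.
move/map_iso_petrie; apply: map_iso_trans; apply: map_iso_sym.
exact: petrie_dualK.
Qed.

(** * Recognising Cayley maps *)

Section CayleySection.

Variables (M : gmap) (F : finFieldType) (l : flag M -> F) (s : cyclic_ordering F).
Hypotheses (lab : labelling l) (bd : boundaryless M).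

Local Notation r0 := (R_0 M).
Local Notation r1 := (R_1 M).
Local Notation r2 := (R_2 M).
Local Notation unitF := {unit F}.

Variable pt : F -> unitF -> flag M.
Hypothesis l_pt : forall v x, l (pt v x) = v.
Hypothesis l_r0pt : forall v x, l (r0 (pt v x)) = (v + val x)%R.
Hypothesis pt_next : forall v x, r1 (pt v x) = r2 (pt v (next s x)).
Hypothesis pt_r0 : forall v x, r0 (pt v x) = r2 (pt (v + val x)%R (oppu x)).

(** [pt v x] is the flag at [v] towards [v + x] in a chosen orientation at [v];
the last hypothesis says that the orientations at the two ends agree. *)
Lemma cayley_of_section : map_iso M (cayley_map s).
Proof.
have pt_prev v x : r1 (r2 (pt v x)) = pt v (prev s x).
  by rewrite -{1}(next_prev (ord_seq_uniq s) x) -pt_next R1K.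
pose g (t : cayley_flag F) : flag M :=
  let: (v, x, b) := t in if b then pt v x else r2 (pt v x).
have g_bij : bijective g.
  apply: inj_surj_bij => [[[v x] b] [[v' x'] b'] e|y].
    have ev : v = v'.
      by have := congr1 l e; case: b b' {e} => -[]; rewrite /= ?(lab2 lab) !l_pt.
    have ex : x = x'.
      apply: val_inj; apply: (@addrI _ v); rewrite {2}ev -!l_r0pt.
      have := congr1 (fun z => l (r0 z)) e.
      by case: b b' {e} => -[]; rewrite /= ?R02C ?(lab2 lab).
    move: e; rewrite -ev -ex => e; congr (_, _, _).
    have [_ _ /eqP r2n] := bd (pt v x).
    by case: b b' e => -[] //= e; case: r2n.
  have yU : (l (r0 y) - l y)%R \is a GRing.unit by rewrite unitfE subr_eq0 (lab0 lab).
  pose yx : unitF := Sub (l (r0 y) - l y)%R yU.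
  have l_arc : l (r0 (pt (l y) yx)) = l (r0 y) by rewrite l_r0pt /= addrC subrK.
  have [->|->] := lab_arc lab (l_pt (l y) yx) l_arc.
    by exists (l y, yx, true).
  by exists (l y, yx, false).
have g1 t : g (R_1 (cayley_map s) t) = r1 (g t).
  by case: t => [[v x] []]; rewrite /= permE /= ?pt_next ?pt_prev.
have g2 t : g (R_2 (cayley_map s) t) = r2 (g t).
  by case: t => [[v x] []]; rewrite /= permE /= ?R2K.
apply: map_iso_sym; exists g; split=> //.
by case=> [[v x] []]; rewrite /= permE /= ?R02C pt_r0 ?R2K.
Qed.

End CayleySection.

(** Here [rho] translated from 0 orients the star of every vertex.  The translations
and the multiplication by [d] preserve these orientations, so the twist of an edge
depends only on its direction, and not even on that since [d] and -1 generate the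
multiplicative group. *)
Section CayleyIso.

Variables (M : gmap) (F : finFieldType) (l : flag M -> F).
Hypotheses (lab : labelling l) (conn : connected M) (bd : boundaryless M).
Hypothesis F_gt3 : 3 < #|F|.

Local Notation r0 := (R_0 M).
Local Notation r1 := (R_1 M).
Local Notation r2 := (R_2 M).
Local Notation rho := (rho M).

Variables (x0 : flag M) (s : cyclic_ordering F) (d : F) (k : nat) (m : {perm flag M}).
Hypothesis lx0 : l x0 = 0%R.
Hypothesis nbr_s : forall i, nbr l x0 i = val (nth 1 s (i %% #|F|.-1)).
Hypothesis translations : forall t : F, exists2 a, a \in Aut_map M &
  forall x, l (a x) = (l x + t)%R.
Hypotheses (m_aut : m \in Aut_map M) (l_m : forall x, l (m x) = (d * l x)%R).
Hypothesis m_x0 : m x0 = (rho ^+ k) x0.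
Hypothesis d_gen : forall x : F, x != 0%R ->
  exists i, x = (d ^+ i)%R \/ x = (- d ^+ i)%R.

Local Notation unitF := {unit F}.

Let lift_eq a b : a \in Aut_map M -> b \in Aut_map M ->
  (forall x, l (a x) = l (b x)) -> a = b.
Proof.
move=> aA bA e; have F1 : 1 < #|F| by lia.
have [u a_u] := aut_lifts lab F1 aA.
apply: (lifts_inj lab conn bd F1 F_gt3 a_u).
by apply/liftsP; split=> // x; rewrite -e; have /liftsP[_ ->] := a_u.
Qed.

Let size_s : size s = #|F|.-1.
Proof.
rewrite -card_finField_unit cardsT -(card_uniqP (ord_seq_uniq s)).
by apply: eq_card => x; rewrite ord_seq_full.
Qed.

Let nbr_index (x : unitF) : nbr l x0 (index x s) = val x.
Proof.
by rewrite nbr_s modn_small -?size_s ?index_mem ?ord_seq_full // nth_index ?ord_seq_full.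
Qed.

Let unit_neq0 (x : unitF) : val x != 0%R.
Proof. by rewrite -unitfE (valP x). Qed.

Lemma cayley_iso : iso_up_to_petrie M (cayley_map s).
Proof.
have /fin_all_exists2[tr trA trl] := translations.
pose pt (v : F) (x : unitF) := tr v ((rho ^+ index x s) x0).
have l_pt v x : l (pt v x) = v by rewrite /pt trl lab_rho // lx0 add0r.
have aut0 a y : a \in Aut_map M -> a (r0 y) = r0 (a y) by move=> /Aut_mapP[->].
have aut2 a y : a \in Aut_map M -> a (r2 y) = r2 (a y) by move=> /Aut_mapP[_ _ ->].
have l_r0pt v x : l (r0 (pt v x)) = (v + val x)%R.
  by rewrite /pt -aut0 // trl -nbr_index addrC.
have pt_at v i (x : unitF) : nbr l x0 i = val x -> tr v ((rho ^+ i) x0) = pt v x.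
  by rewrite -nbr_index => /(nbr_inj lab bd)->.
have rho_pt v x : rho (pt v x) = pt v (next s x).
  have := aut_rho 1 ((rho ^+ index x s) x0) (trA v); rewrite expg1 => <-.
  rewrite -rhoSr; apply: pt_at; rewrite nbr_s next_nth ord_seq_full.
  have : x \in (s : seq _) := ord_seq_full s x.
  rewrite -size_s; case: (ord_seq s) => [//|y p] xs.
  rewrite -index_mem in xs; move: (index x _) xs => i.
  rewrite ltnS leq_eqVlt => /orP[/eqP->|lt_ix]; first by rewrite modnn [in RHS]nth_default.
  by rewrite modn_small //= (set_nth_default y).
have tr_pt t v x : tr t (pt v x) = pt (v + t)%R x.
  rewrite /pt -permM; congr (fun_of_perm _ _).
  by apply: lift_eq; rewrite ?groupM // => y; rewrite permM !trl addrA.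
have d_neq0 : d != 0%R.
  have [y ly] := lab_surj lab (ltnW (ltnW F_gt3)) 1%R.
  have := l_m (m^-1 y); rewrite permKV ly => e1.
  by apply: contra_neq (oner_neq0 F) => d0; rewrite e1 d0 mul0r.
have dU : d \is a GRing.unit by rewrite unitfE.
pose dx x := (Sub d dU : unitF) * x.
have val_dx x : val (dx x) = (d * val x)%R by [].
have m_pt v x : m (pt v x) = pt (d * v)%R (dx x).
  have mtr : tr v * m = m * tr (d * v)%R.
    by apply: lift_eq; rewrite ?groupM // => y; rewrite !permM l_m !trl l_m mulrDr.
  have -> : m (pt v x) = tr (d * v)%R (m ((rho ^+ index x s) x0)) by rewrite -!permM -mtr.
  rewrite aut_rho // m_x0 -rhoX_add; apply: pt_at.
  rewrite /nbr rhoX_add -m_x0 -aut_rho // -aut0 // l_m -/(nbr l x0 _).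
  by rewrite nbr_index.
have r0_pt v x : r0 (pt v x) = r2 (pt (v + val x)%R (oppu x)) \/
                 r0 (pt v x) = pt (v + val x)%R (oppu x).
  have e1 : l (pt (v + val x)%R (oppu x)) = l (r0 (pt v x)) by rewrite l_r0pt l_pt.
  have [|->|->] := lab_arc lab e1; last by left.
    by rewrite l_r0pt R0K l_pt val_oppu addrK.
  by right.
(* [tw x]: the orientations at 0 and at x agree along the edge between them. *)
pose tw x := r0 (pt 0%R x) == r2 (pt (val x) (oppu x)).
have tw_v v x : (r0 (pt v x) == r2 (pt (v + val x)%R (oppu x))) = tw x.
  rewrite -(inj_eq (@perm_inj _ (tr (- v)%R))) aut0 ?aut2 // !tr_pt subrr.
  by rewrite addrAC subrr add0r.
have tw_d x : tw (dx x) = tw x.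
  rewrite -[tw x](inj_eq (@perm_inj _ m)) aut0 ?aut2 // !m_pt mulr0.
  congr (_ == r2 (pt _ _)); apply: val_inj.
  by rewrite val_oppu /= val_oppu mulrN.
have oppuK x : oppu (oppu x) = x :> unitF.
  by apply: val_inj; rewrite !val_oppu opprK.
have tw_opp x : tw (oppu x) = tw x.
  rewrite -(tw_v (val x)) val_oppu subrr oppuK /tw.
  rewrite -(inj_eq (@perm_inj _ r2)) R2K -R02C -(inj_eq (@perm_inj _ r0)) R0K.
  by rewrite eq_sym.
have tw_const x : tw x = tw 1.
  have twX i : tw (iter i dx 1) = tw 1 by elim: i => //= i IH; rewrite tw_d.
  have valX i : val (iter i dx 1) = (d ^+ i)%R by elim: i => //= i IH; rewrite exprS -IH.
  have [i [e|e]] := d_gen (unit_neq0 x).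
    by rewrite -(twX i); congr tw; apply: val_inj; rewrite valX.
  rewrite -(twX i) -[RHS]tw_opp; congr tw; apply: val_inj.
  by rewrite val_oppu valX.
have pt_next v x : r1 (pt v x) = r2 (pt v (next s x)).
  by rewrite -rho_pt rhoE R2K.
have [tw1|tw1] := boolP (tw 1).
  left; apply: (cayley_of_section lab bd l_pt l_r0pt pt_next) => v x.
  by apply/eqP; rewrite tw_v tw_const.
right; apply: iso_petrie_dual.
have l_r0pt' v x : l (R_0 (petrie_dual M) (pt v x)) = (v + val x)%R.
  by rewrite /= permM (lab2 lab).
apply: (cayley_of_section (petrie_labelling lab) (petrie_boundaryless lab bd)
          l_pt l_r0pt' pt_next) => v x.
rewrite /= permM; congr (r2 _).
by have := r0_pt v x; case=> // /eqP; rewrite tw_v tw_const (negPf tw1).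
Qed.

End CayleyIso.

(** * Maps with an affine group of automorphisms *)

Lemma labelling_comp (M : gmap) (V W : finType) (l : flag M -> V) (f : V -> W) :
  labelling l -> bijective f -> labelling (f \o l).
Proof.
move=> [l1 l2 lO l0 lA lC] [g fK gK]; have f_inj := can_inj fK.
split=> [x|x|x y|x|x y|u v uv] /=; rewrite ?l1 ?l2 ?(inj_eq f_inj) //.
- by move/f_inj; apply: lO.
- by move=> /f_inj e /f_inj; apply: lA.
have [|x lx ly] := lC (g u) (g v); first by rewrite (can_eq gK).
by exists x; rewrite /= ?lx ?ly gK.
Qed.

Lemma nth_pairs (T : Type) (x0 : T) (a b : nat -> T) m h k : k < 2 * h ->
  nth x0 (flatten [seq [:: a i; b i] | i <- iota m h]) k =
    if odd k then b (m + k./2) else a (m + k./2).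
Proof.
elim: h m k => [|h IH] m k; first by rewrite muln0.
case: k => [|[|k]] lt_k /=; rewrite ?addn0 //.
by rewrite negbK IH ?addSnnS //; lia.
Qed.

Lemma double_odd_succ_mod4 m : odd m -> (2 * m).+1 %% 4 = 3.
Proof. by have := odd_double_half m; lia. Qed.

Definition power_cayley_map (M : gmap) (n : nat) : Prop :=
  exists (F : finFieldType) (c : {unit F}) (hc : primitive_element c),
    #|F| = n /\ iso_up_to_petrie M (M_c hc).

Definition shuffled_cayley_map (M : gmap) (n : nat) : Prop :=
  exists (F : finFieldType) (c : {unit F}) (j : nat)
         (hc : primitive_element c) (hF : odd #|F|) (hj : odd j),
    [/\ #|F| = n, n %% 4 = 3, j < n.-1, j <> 1%N & iso_up_to_petrie M (M_cj hc hF hj)].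

Section RotaryMaps.

Variables (M : gmap) (V : finType) (l : flag M -> V).
Hypotheses (lab : labelling l) (conn : connected M) (bd : boundaryless M).
Hypothesis V_gt3 : 3 < #|V|.

Local Notation r0 := (R_0 M).
Local Notation rho := (rho M).

Variable H : {group {perm V}}.
Hypothesis sHG : forall h, h \in H -> exists a, lifts l a h.
Hypothesis homog : forall u v u' v' : V, u != v -> u' != v' ->
  exists2 h, h \in H & (h u = u' /\ h v = v') \/ (h u = v' /\ h v = u').
Hypothesis free : forall h u v, h \in H -> u != v -> h u = u -> h v = v -> h = 1.
Hypothesis rot : forall a h x, h \in H -> lifts l a h -> h (l x) = l x ->
  exists i, a x = (rho ^+ i) x.

(** The rotations fixing 0 that come from automorphisms multiply labels by the
label of the image of 1.  If the rotation by one step is among them, the cyclic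
order is that of the powers of one element.  If not, then neither -1 nor the
second neighbour is in the orbit C of 1, whereas the third is, say d; so C consists
of the powers of d, it has index 2 and odd order m, and c = - d^((m+1)/2) is a
square root of d that generates the multiplicative group. *)
Theorem rotary_map : power_cayley_map M #|V| \/ shuffled_cayley_map M #|V|.
Proof.
have V_gt1 : 1 < #|V| by lia.
have /card_gt0P[o _] : 0 < #|V| by lia.
have [x0 lx0] := lab_surj lab V_gt1 o; pose e := nbr l x0 0.
have eo : e != o by rewrite -lx0; apply: nbr_neq.
have stab_comm g h : g \in H -> h \in H -> g o = o -> h o = o -> g * h = h * g.
  move=> gH hH go ho; have [a a_g] := sHG gH; have [b b_h] := sHG hH.
  have [i ai] : exists i, a x0 = (rho ^+ i) x0 by apply: rot gH a_g _; rewrite lx0.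
  have [j bj] : exists i, b x0 = (rho ^+ i) x0 by apply: rot hH b_h _; rewrite lx0.
  have aA : a \in Aut_map M by case/andP: a_g.
  have bA : b \in Aut_map M by case/andP: b_h.
  have ab : a * b = b * a.
    apply: (Aut_free conn (x := x0)); rewrite ?groupM //.
    by rewrite !permM ai bj !aut_rho // ai bj -!rhoX_add addnC.
  apply: (lifts_uniq lab V_gt1 (liftsM a_g b_h)); rewrite ab.
  exact: liftsM.
have [F [f [fbij [fo fe] ftr fmul fsgn]]] := homog_affine V_gt3 homog free stab_comm eo.
have cardF : #|F| = #|V| by rewrite (bij_eq_card fbij).
have F_gt3 : 3 < #|F| by rewrite cardF.
pose l' := f \o l; have lab' : labelling l' := labelling_comp lab fbij.
have l'x0 : l' x0 = 0%R by rewrite /l' /= lx0.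
pose N i := nbr l' x0 i.
have N0 : N 0%N = 1%R by [].
have translations (t : F) : exists2 a, a \in Aut_map M & forall x, l' (a x) = (l' x + t)%R.
  have [h hH ht] := ftr t; have [a /liftsP[aA a_h]] := sHG hH.
  by exists a => // x; rewrite /l' /= a_h ht.
(* [S i]: the rotation by i steps around 0 comes from an automorphism that
   multiplies the labels by N i. *)
pose S i := [exists a, [&& a \in Aut_map M, a x0 == (rho ^+ i) x0 &
  [forall x, l' (a x) == (N i * l' x)%R]]].
have SP i : reflect (exists a, [/\ a \in Aut_map M, a x0 = (rho ^+ i) x0 &
    forall x, l' (a x) = (N i * l' x)%R]) (S i).
  apply: (iffP existsP) => -[a].
    by case/and3P=> aA /eqP ax0 /forallP al; exists a; split=> // x; apply/eqP.
  by case=> aA ax0 al; exists a; rewrite aA ax0 eqxx; apply/forallP=> x; apply/eqP.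
have S_signed (x : F) : x != 0%R -> exists2 i, S i & N i = x \/ N i = (- x)%R.
  move=> x_neq0; have [h [hH ho] hx] := fsgn x x_neq0.
  have [a a_h] := sHG hH; have /liftsP[aA al] := a_h.
  have [i ai] : exists i, a x0 = (rho ^+ i) x0 by apply: rot hH a_h _; rewrite lx0.
  have Ni : N i = f (h e).
    by rewrite (lifts_nbr _ _ a_h) /N /nbr ai perm1.
  exists i; last by rewrite Ni.
  by apply/SP; exists a; split=> // y; rewrite /l' /= al fmul // Ni.
have S_mul i j : S i -> N (i + j) = (N i * N j)%R.
  case/SP=> a [aA ax0 al]; rewrite {1 3}/N /nbr -al rhoX_add -ax0 -aut_rho //.
  by have /Aut_mapP[-> _ _] := aA.
have S_add i j : S i -> S j -> S (i + j).
  move=> Si; have := S_mul _ j Si; move: Si => /SP[a [aA ax0 al]] Nij /SP[b [bA bx0 bl]].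
  apply/SP; exists (b * a); split; first by rewrite groupM.
    by rewrite permM bx0 aut_rho // ax0 -rhoX_add.
  by move=> x; rewrite permM al bl mulrA Nij.
have N_eq i j : N i = N j <-> i = j %[mod #|F|.-1] := nbr_eq_mod lab' bd x0 i j.
have S_eq i j : N i = N j -> S i -> S j.
  move=> Nij /SP[a [aA ax0 al]]; apply/SP; exists a; split=> //.
    by rewrite ax0; apply: nbr_inj Nij.
  by move=> x; rewrite al Nij.
have N_surj (x : F) : x != 0%R -> exists i, N i = x.
  by rewrite -l'x0 => /(nbr_surj lab').
have N_neq0 i : N i != 0%R by rewrite -l'x0; apply: nbr_neq.
have N_mod i : N (i %% #|F|.-1) = N i by apply/N_eq; rewrite modn_mod.
have powers (c : {unit F}) d k : (forall i, N i = val c ^+ i)%R -> N k = d -> S k ->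
    (forall x : F, x != 0%R -> exists i, x = (d ^+ i)%R \/ x = (- d ^+ i)%R) ->
  power_cayley_map M #|V|.
  move=> NX Nk /SP[a [aA ax0 al]] dgen.
  have hc : primitive_element c.
    rewrite /primitive_element /generator eqEsubset subsetT andbT.
    apply/subsetP=> x _; have [|i Ni] := N_surj (val x); first by rewrite -unitfE (valP x).
    by apply/cycleP; exists i; apply: val_inj; rewrite FinRing.val_unitX -NX.
  exists F, c, hc; split=> //.
  apply: (cayley_iso lab' conn bd F_gt3 l'x0 _ translations aA _ ax0 dgen).
    move=> i; rewrite -/(N i) -N_mod NX (nth_map 0) ?size_iota ?ltn_mod; last by lia.
    by rewrite nth_iota ?ltn_mod ?FinRing.val_unitX //; lia.
  by move=> x; rewrite al Nk.
have [S1|nS1] := boolP (S 1%N).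
  have NX i : N i = (N 1%N ^+ i)%R.
    by elim: i => [|i IH]; rewrite ?N0 // -add1n S_mul // IH exprS.
  left; have cU : N 1%N \is a GRing.unit by rewrite unitfE.
  apply: (powers (Sub (N 1%N) cU) (N 1%N) 1%N) => // x /N_surj[i <-].
  by exists i; left.
have [i1 Si1 Ni1] : exists2 i, S i & N i = (- N 1%N)%R.
  have [i Si [Ni|Ni]] := S_signed _ (N_neq0 1%N); last by exists i.
  by rewrite (S_eq _ _ Ni) in nS1.
(* -1 is not in the orbit of 1: together with the product of -1 and N 1, which
   is, it would put N 1 there. *)
have no_neg1 i : S i -> N i != (- 1)%R.
  move=> Si; apply: contra nS1 => /eqP Ni.
  by apply: S_eq (S_add _ _ Si Si1); rewrite S_mul // Ni Ni1 mulN1r opprK.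
(* The quotient of N 2 by N 1 is in the orbit of 1 up to sign; so is N 1, and in
   neither case without the sign, hence the signs cancel. *)
have S2 : S 2.
  have [|k Sk Nk] := S_signed (N 2 / N 1%N)%R.
    by rewrite mulf_neq0 ?invr_eq0.
  case: Nk => Nk.
    have : N (k + 1) = N 2 by rewrite S_mul // Nk divfK.
    move/N_eq => e2; have : N k = N 1%N by apply/N_eq/eqP; rewrite -(eqn_modDr 1) e2.
    by move/S_eq/(_ Sk); rewrite (negPf nS1).
  apply: S_eq (S_add _ _ Sk Si1); rewrite S_mul // Nk Ni1.
  by rewrite mulrNN divfK.
pose d := N 2.
have Seven i : S (2 * i)%N.
  elim: i => [|i IH]; last by rewrite mulnS S_add.
  by apply/SP; exists 1; split=> [||x]; rewrite ?group1 ?perm1 // N0 mul1r.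
have Neven i : N (2 * i)%N = (d ^+ i)%R.
  by elim: i => [|i IH]; rewrite ?muln0 // mulnS S_mul // IH exprS.
have Nodd i : N (2 * i).+1%N = (d ^+ i * N 1%N)%R.
  by rewrite -addn1 S_mul // Neven.
have [m card_m] : exists m, #|F| = (2 * m).+1%N.
  exists #|F|./2; case oddF : (odd #|F|); first by have := odd_double_half #|F|; lia.
  case/negP: nS1; apply: S_eq (Seven #|F|./2).
  apply/N_eq; have -> : (2 * #|F|./2 = #|F|.-1 + 1)%N.
    by have := odd_double_half #|F|; lia.
  by rewrite modnDl.
have m_gt1 : 1 < m by lia.
have card_m' : #|F|.-1 = (2 * m)%N by rewrite card_m.
have dm : (d ^+ m = 1)%R by rewrite -Neven -N0; apply/N_eq; rewrite card_m' modnn mod0n.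
have m_odd : odd m.
  apply: contraT => m_even; have := no_neg1 _ (Seven m./2); rewrite Neven.
  have y2 : ((d ^+ m./2) ^+ 2 = 1)%R.
    by rewrite -exprM muln2 even_halfK.
  have : (((d ^+ m./2) == 1) || ((d ^+ m./2) == -1))%R by rewrite -sqrf_eq1 y2.
  case/orP=> [|->//]; rewrite -Neven -N0 => /eqP/N_eq.
  rewrite card_m' mod0n modn_small; last by have := even_halfK m_even; lia.
  by have := even_halfK m_even; lia.
have d_neq0 : d != 0%R by apply: N_neq0.
pose c0 : F := (- d ^+ m.+1./2)%R.
have c0U : c0 \is a GRing.unit by rewrite unitfE oppr_eq0 expf_neq0.
pose c : {unit F} := Sub c0 c0U.
have c2 : (c0 ^+ 2 = d)%R.
  rewrite sqrrN -exprM; have -> : (m.+1./2 * 2 = m + 1)%N by have := odd_double_half m; lia.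
  by rewrite exprD dm mul1r.
have cm : (c0 ^+ m = -1)%R.
  by rewrite exprNn -signr_odd m_odd expr1 mulN1r -exprM mulnC exprM dm expr1n.
have c2m i : (c0 ^+ (i %% (2 * m)%N) = c0 ^+ i)%R.
  rewrite {2}(divn_eq i (2 * m)%N) exprD [(_ * (2 * m))%N]mulnC -mulnA exprM c2 exprM.
  by rewrite dm expr1n mul1r.
have [j0 Nj0] : exists j, N j.*2.+1 = (-1)%R.
  have [|j Nj] := N_surj (-1)%R; first by rewrite oppr_eq0 oner_neq0.
  have oddj : odd j.
    apply: contraT => evj; have := no_neg1 _ (Seven j./2).
    by rewrite mul2n even_halfK // Nj eqxx.
  by exists j./2; rewrite -[RHS]Nj -[in RHS](odd_double_half j) oddj.
pose j := ((m + 2 * (m.-1 * j0)) %% (2 * m))%N.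
have N1 : N 1%N = (c0 ^+ j)%R.
  rewrite /j c2m exprD cm exprM c2 mulN1r; apply: (mulfI (expf_neq0 j0 (N_neq0 2))).
  rewrite -Nodd mul2n Nj0 mulrN -exprD; congr (- _)%R.
  rewrite (_ : (j0 + m.-1 * j0 = m * j0)%N) ?exprM ?dm ?expr1n //.
  by rewrite -mulSn prednK // (ltnW m_gt1).
have j_odd : odd j.
  by rewrite /j odd_mod ?oddM // oddD m_odd oddM.
have j_lt : j < #|V|.-1 by rewrite -cardF card_m' /j ltn_pmod // muln_gt0 (ltnW m_gt1).
have d_gen (x : F) : x != 0%R -> exists i, x = (d ^+ i)%R \/ x = (- d ^+ i)%R.
  case/N_surj=> i <-; rewrite -(odd_double_half i) -mul2n; case: (odd i); last first.
    by exists i./2; left; rewrite add0n Neven.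
  exists (i./2 + m.-1 * j0)%N; right; rewrite add1n Nodd N1 /j c2m exprD cm.
  by rewrite exprM c2 mulN1r mulrN exprD.
have [j1|j1] := eqVneq j 1%N.
  left; apply: (powers c d 2) => // i.
  rewrite -(odd_double_half i) -mul2n exprD exprM c2 -Neven; case: (odd i).
    by rewrite add1n Nodd N1 j1 mulrC -Neven.
  by rewrite add0n mul1r.
have hc : primitive_element c.
  rewrite /primitive_element /generator eqEsubset subsetT andbT.
  apply/subsetP=> x _; have [|i Ni] := N_surj (val x); first by rewrite -unitfE (valP x).
  apply/cycleP; exists (2 * i./2 + j * odd i)%N; apply: val_inj.
  rewrite FinRing.val_unitX -Ni exprD exprM c2 -[in LHS](odd_double_half i) -mul2n.
  case: (odd i); last by rewrite add0n Neven muln0 mulr1.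
  by rewrite add1n Nodd N1 muln1.
have oddF : odd #|F| by rewrite card_m /= oddM.
right; exists F, c, j, hc, oddF, j_odd; split=> //.
- by rewrite -cardF card_m double_odd_succ_mod4.
- exact/eqP.
have /SP[a [aA ax0 al]] := S2.
apply: (cayley_iso lab' conn bd F_gt3 l'x0 _ translations aA al ax0 d_gen).
move=> i; rewrite -/(N i) -N_mod card_m' nth_pairs; last first.
  have -> : (#|F|.-1)./2 = m by rewrite card_m' mul2n doubleK.
  by rewrite ltn_pmod // muln_gt0 (ltnW m_gt1).
set k := (i %% _)%N; rewrite add0n -{1}(odd_double_half k) -mul2n.
case: (odd k); rewrite FinRing.val_unitX.
  by rewrite add1n Nodd N1 exprD exprM c2 mulrC.
by rewrite add0n Neven exprM c2.
Qed.

End RotaryMaps.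

(** * Edge stabilisers *)

Section Dichotomy.

Variables (M : gmap) (V : finType) (l : flag M -> V).
Hypotheses (lab : labelling l) (conn : connected M) (bd : boundaryless M).
Hypothesis V_gt3 : 3 < #|V|.
Hypothesis edge_tr : edge_transitive M.

Local Notation r0 := (R_0 M).
Local Notation r2 := (R_2 M).
Local Notation rho := (rho M).

Let V_gt1 : 1 < #|V|. Proof. exact: ltnW (ltnW V_gt3). Qed.

(** An automorphism acting on the star of a vertex as a reflection permutes the
neighbours by j |-> i - j. *)
Lemma refl_nbr a (s : {perm V}) x i j : lifts l a s ->
  a x = r2 ((rho ^+ (i + j)) x) -> s (nbr l x j) = nbr l x i.
Proof.
move=> a_s ax; rewrite (lifts_nbr _ _ a_s) /nbr ax rhoX_add rho_r2.
by rewrite R02C (lab2 lab).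
Qed.

Lemma refl_involution a x i j : a \in Aut_map M ->
  a x = (rho ^+ j) (r2 ((rho ^+ i) x)) -> a * a = 1.
Proof.
move=> aA ax; have /Aut_mapP[_ _ a2] := aA.
apply: (Aut_free conn (x := x)); rewrite ?groupM //.
rewrite permM {1}ax aut_rho // a2 aut_rho // ax perm1.
by rewrite -rhoX_add addnC rhoX_add rho_r2 rho_r2 R2K.
Qed.

Lemma lifts_neq1 a s : lifts l a s -> a != 1 -> s != 1.
Proof.
by move=> a_s; apply: contra_neq => s1; rewrite s1 in a_s; apply: lifts_faithful a_s.
Qed.

(** It exchanges two vertices, because the action on vertices is faithful, hence
fixes the edge between them. *)
Lemma involution_flips a : a \in Aut_map M -> a * a = 1 -> a != 1 ->
  exists y, a y = r0 y \/ a y = r0 (r2 y).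
Proof.
move=> aA aa a1; have [s a_s] := aut_lifts lab V_gt1 aA.
have s1 := lifts_neq1 a_s a1.
have ss : s * s = 1.
  by apply: (lifts_uniq lab V_gt1 (liftsM a_s a_s)); rewrite aa; apply: lifts1.
have [u us] : exists u, s u != u.
  apply/existsP; apply: contraNT s1; rewrite negb_exists => /forallP fixs.
  by apply/eqP/permP=> u; rewrite perm1; apply/eqP; have := fixs u; rewrite negbK.
rewrite eq_sym in us; have [y ly l0y] := lab_complete lab us; exists y.
have /liftsP[_ al] := a_s; have /Aut_mapP[a0 _ _] := aA.
have e1 : l (r0 y) = l (a y) by rewrite al ly.
have e2 : l (r0 (r0 y)) = l (r0 (a y)) by rewrite R0K -a0 al l0y -permM ss perm1.
by have [->|->] := lab_arc lab e1 e2; rewrite ?R02C; auto.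
Qed.

(** Whether [w], one of R_0, R_2 and R_0R_2, agrees at a flag with an automorphism
does not depend on the flag: by edge-transitivity it can be transported to the four
flags of any edge, on which [w] commutes with R_0 and R_2. *)
Lemma edge_type (w : {perm flag M}) :
    (forall x, w (r0 x) = r0 (w x)) -> (forall x, w (r2 x) = r2 (w x)) ->
    (forall a x, a \in Aut_map M -> w (a x) = a (w x)) ->
  forall x y, (exists2 a, a \in Aut_map M & a x = w x) ->
  exists2 a, a \in Aut_map M & a y = w y.
Proof.
move=> w0 w2 wA x y [a aA ax]; have [b bA bx] := edge_transP edge_tr x y.
have cA : a ^ b \in Aut_map M by rewrite groupJ.
have [c0 _ c2] := Aut_mapP _ cA; exists (a ^ b) => //.
have cbx : (a ^ b) (b x) = w (b x).
  by rewrite conjgE !permM permK ax wA.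
case: bx cbx => ->; rewrite ?c0 ?c2 ?w0 ?w2 //.
- by move/perm_inj.
- by move/perm_inj.
by move=> /perm_inj/perm_inj.
Qed.

Lemma R0_type x y : (exists2 a, a \in Aut_map M & a x = r0 x) ->
  exists2 a, a \in Aut_map M & a y = r0 y.
Proof. by apply: edge_type => // [z|a z /Aut_mapP[]] //; rewrite R02C. Qed.

Lemma R2_type x y : (exists2 a, a \in Aut_map M & a x = r2 x) ->
  exists2 a, a \in Aut_map M & a y = r2 y.
Proof. by apply: edge_type => // [z|a z /Aut_mapP[]] //; rewrite R02C. Qed.

Lemma R02_type x y : (exists2 a, a \in Aut_map M & a x = r0 (r2 x)) ->
  exists2 a, a \in Aut_map M & a y = r0 (r2 y).
Proof.
have E z : (r2 * r0) z = r0 (r2 z) by rewrite permM.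
rewrite -!E; apply: edge_type => [z|z|a z /Aut_mapP[a0 _ a2]]; rewrite !E.
- by rewrite -R02C.
- by rewrite -R02C.
by rewrite a0 a2.
Qed.

Lemma flip_all y0 : (exists2 a, a \in Aut_map M & a y0 = r0 y0 \/ a y0 = r0 (r2 y0)) ->
  forall y, exists2 a, a \in Aut_map M & a y = r0 y \/ a y = r0 (r2 y).
Proof.
case=> a aA [ay|ay] y.
  have [|b bA by_] := @R0_type y0 y; first by exists a.
  by exists b; auto.
have [|b bA by_] := @R02_type y0 y; first by exists a.
by exists b; auto.
Qed.

Lemma vertex_group_homog u v u' v' : u != v -> u' != v' ->
  exists2 h, h \in vertex_group l & (h u = u' /\ h v = v') \/ (h u = v' /\ h v = u').
Proof.
move=> /(lab_complete lab)[x <- <-] /(lab_complete lab)[x' <- <-].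
have [a aA ax] := edge_transP edge_tr x x'; have [s a_s] := aut_lifts lab V_gt1 aA.
exists s; first by apply/vertex_groupP; exists a.
have /liftsP[_ al] := a_s; have /Aut_mapP[a0 _ _] := aA.
by rewrite -!al a0; case: ax => ->; rewrite ?R0K ?R02C ?R2K ?(lab2 lab) ?R0K; auto.
Qed.

Lemma arc_transitive : (forall y, exists2 a, a \in Aut_map M & a y = r0 y \/ a y = r0 (r2 y)) ->
  forall x y, exists2 a, a \in Aut_map M & a x = y \/ a x = r2 y.
Proof.
move=> flips x y; have [a aA ax] := edge_transP edge_tr x y.
have [b bA bax] := flips (a x); have abA : a * b \in Aut_map M by rewrite groupM.
case: ax bax => ax; rewrite ?ax => bax; try by exists a; auto.
  by exists (a * b) => //; rewrite permM ax; case: bax => ->; rewrite -?R02C ?R0K; auto.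
exists (a * b) => //; rewrite permM ax.
by case: bax => ->; rewrite ?R02C ?R0K ?R2K; auto.
Qed.

(** When no automorphism acts on a flag as R_2, what remains for [rotary_map] is to
exclude reflections in the stabiliser of a vertex: a reflection there is the only
involution, but it yields transitivity on arcs, and an automorphism taking an arc
to another one is either a reflection or, composed with the given one, gives
one. *)
Theorem rotary_or_regular :
  (power_cayley_map M #|V| \/ shuffled_cayley_map M #|V|)
  \/ (forall x y, exists2 a, a \in Aut_map M & a x = y).
Proof.
have /card_gt0P[o _] : 0 < #|V| by apply: ltnW V_gt1.
have [x0 lx0] := lab_surj lab V_gt1 o.
have [/existsP[a2 /andP[a2A /eqP a2x0]]|no2] :=
  boolP [exists a, (a \in Aut_map M) && (a x0 == r2 x0)].
  right; have a22 : a2 * a2 = 1.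
    apply: (Aut_free conn (x := x0)); rewrite ?groupM // permM a2x0 perm1.
    by have /Aut_mapP[_ _ ->] := a2A; rewrite a2x0 R2K.
  have a21 : a2 != 1.
    by apply: contra_not_neq (@star_disjoint _ bd 0 0 x0) => e; rewrite !perm1 -a2x0 e perm1.
  have [y0 flipy0] := involution_flips a2A a22 a21.
  have arcs := arc_transitive (flip_all (ex_intro2 _ _ a2 a2A flipy0)).
  move=> x y; have [a aA [ax|ax]] := arcs x y; first by exists a.
  have [|b bA b_y] := @R2_type x0 (r2 y); first by exists a2.
  by exists (a * b); rewrite ?groupM // permM ax b_y R2K.
left; have no_r2 a y : a \in Aut_map M -> a y <> r2 y.
  move=> aA ay; have [|b bA bx] := @R2_type y x0; first by exists a.
  by case/existsP: no2; exists b; rewrite bA bx eqxx.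
have free h u v : h \in vertex_group l -> u != v -> h u = u -> h v = v -> h = 1.
  move=> /vertex_groupP[a a_h] /(lab_complete lab)[x lx l0x] hu hv.
  have /liftsP[aA al] := a_h; have /Aut_mapP[a0 _ _] := aA.
  have e1 : l x = l (a x) by rewrite al lx.
  have e2 : l (r0 x) = l (r0 (a x)) by rewrite -a0 al l0x.
  have [ax|ax] := lab_arc lab e1 e2; last by case: (no_r2 a x).
  have a1 : a = 1 by apply: (Aut_free conn (x := x)); rewrite ?perm1.
  by apply: (lifts_uniq lab V_gt1 a_h); rewrite a1; apply: lifts1.
apply: (rotary_map lab conn bd V_gt3 _ vertex_group_homog free).
  by move=> h /vertex_groupP.
move=> a h x hG a_h hlx; have /liftsP[aA al] := a_h.
have star y : l y = l (a y) -> exists i, a y = (rho ^+ i) y \/ a y = r2 ((rho ^+ i) y).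
  by move=> e; apply: (star_cases lab).
have [|i [ax|ax]] := star x; [by rewrite al hlx | by exists i | exfalso].
have refl0 : a x = (rho ^+ 0) (r2 ((rho ^+ i) x)) by rewrite perm1.
have aa := refl_involution aA refl0.
have a1 : a != 1.
  by apply: contra_not_neq (@star_disjoint _ bd i 0 x) => e; rewrite -ax e !perm1.
have [y0 flipy0] := involution_flips aA aa a1.
have arcs := arc_transitive (flip_all (ex_intro2 _ _ a aA flipy0)).
have uniq_refl b : b \in Aut_map M -> b * b = 1 -> b != 1 -> l (b x) = l x -> b = a.
  move=> bA bb b1 lbx; have [g b_g] := aut_lifts lab V_gt1 bA.
  have sq c s : lifts l c s -> c * c = 1 -> s * s = 1.
    move=> c_s cc; apply: (lifts_uniq lab V_gt1 (liftsM c_s c_s)).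
    by rewrite cc; apply: lifts1.
  have gh : g = h.
    apply: (stab_involution_unique V_gt3 vertex_group_homog free (o := l x)) => //.
    - by apply/vertex_groupP; exists b.
    - by have /liftsP[_ <-] := b_g.
    - exact: sq bb.
    - exact: sq aa.
    - exact: lifts_neq1 b_g b1.
    exact: lifts_neq1 a_h a1.
  by apply: (lifts_inj lab conn bd V_gt1 V_gt3 b_g); rewrite gh.
(* The star has no other reflection than [a]. *)
have only j : (rho ^+ j) x != x -> (rho ^+ j) x = (rho ^+ i) x.
  move=> jx; have [b bA bx] := arcs x ((rho ^+ j) x).
  have lbx : l (b x) = l x by case: bx => ->; rewrite ?(lab2 lab) lab_rho.
  case: bx => bx; last first.
    have refl_b : b x = (rho ^+ 0) (r2 ((rho ^+ j) x)) by rewrite perm1.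
    have ba : b = a.
      apply: uniq_refl => //; first exact: refl_involution refl_b.
      by apply: contra_not_neq (@star_disjoint _ bd j 0 x) => b1; rewrite -bx b1 !perm1.
    by move: bx; rewrite ba ax => /perm_inj.
  have bax : (b * a) x = (rho ^+ j) (r2 ((rho ^+ i) x)) by rewrite permM bx aut_rho // ax.
  have baA : b * a \in Aut_map M by rewrite groupM.
  have ba1 : b * a != 1.
    apply: contra_not_neq (@star_disjoint _ bd i j x) => ba.
    have b_a : b = a by apply: (@mulIg _ a); rewrite ba aa.
    by rewrite -bx -ax b_a.
  have : b * a = a.
    apply: uniq_refl ba1 _ => //; first exact: refl_involution bax.
    by rewrite bax lab_rho // (lab2 lab) lab_rho.
  rewrite -{2}[a]mul1g => /mulIg b1.
  by move: jx; rewrite -bx b1 perm1 eqxx.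
have n3 : 2 < #|V|.-1 by rewrite -ltnS prednK // ltnW.
have moves j : 0 < j < 3 -> (rho ^+ j) x != x.
  move=> j12; apply/eqP=> e; have : j = 0 %[mod #|V|.-1].
    by apply: (rho_eq_mod lab bd (x := x)); rewrite e perm1.
  case/andP: j12 => j_gt0 j_lt3; rewrite mod0n modn_small => [j0|].
    by rewrite j0 in j_gt0.
  exact: leq_trans j_lt3 n3.
have := rho_eq_mod lab bd (etrans (only 1%N (moves 1%N isT)) (esym (only 2 (moves 2 isT)))).
by rewrite !modn_small // ltnW.
Qed.

End Dichotomy.

(** * Flag-transitive maps: counting involutions *)

Lemma sum_card_exchange (S U : finType) (I : {set S}) (r : U -> S -> bool) :
  (\sum_u #|[set s in I | r u s]| = \sum_(s in I) #|[set u | r u s]|)%N.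
Proof.
transitivity (\sum_(u : U) \sum_(s in I) (r u s : nat))%N.
  apply: eq_bigr => u _.
  rewrite -sum1_card (eq_bigl (fun s => (s \in I) && r u s)) => [|s]; last by rewrite inE.
  by rewrite big_mkcondr; apply: eq_bigr => s _; case: (r u s).
rewrite exchange_big /=; apply: eq_bigr => s _.
by rewrite -sum1_card [RHS]big_mkcond; apply: eq_bigr => u _; rewrite inE; case: (r u s).
Qed.

Section RegularMaps.

Variables (M : gmap) (V : finType) (l : flag M -> V).
Hypotheses (lab : labelling l) (conn : connected M) (bd : boundaryless M).
Hypothesis V_gt3 : 3 < #|V|.
Hypothesis reg : forall x y, exists2 a, a \in Aut_map M & a x = y.

Local Notation r0 := (R_0 M).
Local Notation r2 := (R_2 M).
Local Notation rho := (rho M).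
Local Notation n := #|V|.

Let V_gt1 : 1 < #|V|. Proof. exact: ltnW (ltnW V_gt3). Qed.

(** Automorphisms correspond to flags by their value at [x], so sets of vertex
permutations can be counted as sets of flags. *)
Lemma regular_lifts x : exists P : flag M -> {perm V},
  [/\ injective P, forall y, exists2 a, lifts l a (P y) & a x = y
    & forall a s, lifts l a s -> s = P (a x)].
Proof.
have /fin_all_exists[P PP] : forall y, exists s, exists2 a, lifts l a s & a x = y.
  move=> y; have [a aA ax] := reg x y; have [s a_s] := aut_lifts lab V_gt1 aA.
  by exists s, a.
exists P; split=> // [y z e|a s a_s].
  have [a a_y <-] := PP y; have [b b_z <-] := PP z; rewrite -e in b_z.
  by rewrite (lifts_inj lab conn bd V_gt1 V_gt3 a_y b_z).
have [b b_P e] := PP (a x); apply: (lifts_uniq lab V_gt1 a_s).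
have aA : a \in Aut_map M by case/andP: a_s.
have bA : b \in Aut_map M by case/andP: b_P.
by rewrite {1}(Aut_free conn aA bA (esym e)).
Qed.

Definition involutions : {set {perm V}} :=
  [set s in vertex_group l | (s * s == 1) && (s != 1)].

Lemma involutionsP s : reflect
  (exists a, [/\ lifts l a s, a * a = 1 & a != 1]) (s \in involutions).
Proof.
rewrite inE; apply: (iffP and3P) => [[/vertex_groupP[a a_s] /eqP ss s1]|[a [a_s aa a1]]].
  exists a; split=> //.
    apply: (lifts_inj lab conn bd V_gt1 V_gt3 (liftsM a_s a_s)).
    by rewrite ss; apply: lifts1.
  apply: contra_neq s1 => a1; apply: (lifts_uniq lab V_gt1 a_s).
  by rewrite a1; apply: lifts1.
split; first by apply/vertex_groupP; exists a.
- apply/eqP; apply: (lifts_uniq lab V_gt1 (liftsM a_s a_s)).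
  by rewrite aa; apply: lifts1.
exact: (lifts_neq1 lab conn bd V_gt3 a_s a1).
Qed.

Definition inv_stab u := [set s in involutions | s u == u].

(** An involution taking u to v exchanges them, so it acts on the edge between them
as R_0 or R_0R_2. *)
Lemma card_involutions_move u v : u != v -> #|[set s in involutions | s u == v]| <= 2.
Proof.
move=> uv; have [x lx l0x] := lab_complete lab uv.
have [P [_ _ PE]] := regular_lifts x.
apply: (@leq_trans #|[set P (r0 x); P (r0 (r2 x))]|); last first.
  by rewrite cards2; case: (_ != _).
apply/subset_leq_card/subsetP=> s /setIdP[/involutionsP[a [a_s aa a1]] /eqP su].
have /liftsP[aA al] := a_s; have /Aut_mapP[a0 _ _] := aA.
have ss : s * s = 1.
  by apply: (lifts_uniq lab V_gt1 (liftsM a_s a_s)); rewrite aa; apply: lifts1.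
have e1 : l (r0 x) = l (a x) by rewrite al lx su.
have e2 : l (r0 (r0 x)) = l (r0 (a x)) by rewrite R0K -a0 al l0x lx -su -permM ss perm1.
have -> : s = P (a x) by apply: PE.
by have [->|->] := lab_arc lab e1 e2; rewrite -?R02C !inE eqxx ?orbT.
Qed.

Lemma card_involutions_le u : #|involutions| <= #|inv_stab u| + 2 * n.-1.
Proof.
have -> : #|involutions| = (\sum_v #|[set s in involutions | s u == v]|)%N.
  rewrite -sum1_card (partition_big (fun s : {perm V} => s u) xpredT) //=.
  by apply: eq_bigr => v _; rewrite -sum1_card; apply: eq_bigl => s; rewrite inE.
rewrite (bigD1 u) //= leq_add2l -(cardC1 u) mulnC -sum_nat_const.
rewrite (eq_bigl (fun v => v \in predC1 u)) // leq_sum // => v vu.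
by rewrite card_involutions_move // eq_sym.
Qed.

(** Choosing a flag on the edge of two fixed vertices, the automorphism is R_2 on it
if it is not trivial, and the induced j |-> - j has no other fixed point modulo the
odd number n - 1. *)
Lemma even_fix_three s u v w : ~~ odd n -> s \in vertex_group l ->
  u != v -> w != u -> w != v -> s u = u -> s v = v -> s w = w -> s = 1.
Proof.
move=> n_even /vertex_groupP[a a_s] uv wu wv su sv sw.
have /liftsP[aA al] := a_s; have /Aut_mapP[a0 _ _] := aA.
have [x lx l0x] := lab_complete lab uv.
have e1 : l x = l (a x) by rewrite al lx.
have e2 : l (r0 x) = l (r0 (a x)) by rewrite -a0 al l0x.
have [ax|ax] := lab_arc lab e1 e2.
  have a1 : a = 1 by apply: (Aut_free conn (x := x)); rewrite ?perm1.
  by apply: (lifts_uniq lab V_gt1 a_s); rewrite a1; apply: lifts1.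
case/eqP: wv; have [|j jw] := nbr_surj lab (x := x) (v := w); first by rewrite lx.
have n1 : 0 < n.-1 by rewrite -subn1 subn_gt0.
set j' := (j %% n.-1)%N; have j'_lt : j' < n.-1 by rewrite ltn_mod.
have j'w : nbr l x j' = w by rewrite -jw /nbr (rho_mod lab bd).
have : s (nbr l x j') = nbr l x (n.-1 - j').
  apply: (refl_nbr lab a_s); rewrite subnK ?(ltnW j'_lt) //.
  by rewrite (rho_period lab bd).
rewrite j'w sw -{1}j'w => /(nbr_eq_mod lab bd) e.
have : n.-1 %| j'.
  rewrite -(@Gauss_dvdr _ 2) ?coprimen2 -?subn1 ?oddB ?(negPf n_even) //; last exact: ltnW.
  rewrite subn1 /dvdn mul2n -addnn -modnDml e modnDml subnK ?modnn //.
  exact: ltnW.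
rewrite /dvdn => /eqP j0; rewrite -j'w -l0x /nbr -(rho_mod lab bd) j0.
by rewrite perm1.
Qed.

(** The involutions fixing a vertex are its n - 1 reflections, so there are at most
3(n - 1) involutions.  Each fixes at most two vertices, and counting pairs of an
involution and a fixed vertex gives n(n - 1) <= 6(n - 1), with equality for
n = 6 only if each fixes exactly two. *)
Lemma regular_even_le6 : ~~ odd n -> n <= 6 /\
  (n = 6 -> forall s, s \in involutions -> exists u v, [/\ u != v, s u = u & s v = v]).
Proof.
move=> n_even.
have fix_le2 s : s \in involutions -> #|[set u | s u == u]| <= 2.
  rewrite inE => /and3P[sG _ s1]; rewrite leqNgt; apply: contra s1.
  case/card_gt2P=> u [v [w [[]]]]; rewrite !inE => /eqP su /eqP sv /eqP sw [uv vw wu].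
  by apply/eqP; apply: (even_fix_three n_even sG uv wu _ su sv sw); rewrite eq_sym.
have stab_card u : #|inv_stab u| = n.-1.
  have [x lx] := lab_surj lab V_gt1 u; have [P [P_inj PP PE]] := regular_lifts x.
  have <- : #|P @: (r2 @: porbit rho x)| = n.-1.
    by rewrite !card_imset ?(card_star lab bd) //; apply: perm_inj.
  apply: eq_card => s; apply/setIdP/imsetP.
    case=> /involutionsP[a [a_s aa a1]] /eqP su; have /liftsP[aA al] := a_s.
    exists (a x); last exact: PE.
    have lax : l x = l (a x) by rewrite al lx su.
    have [i [ai|ai]] := star_cases lab lax; last by rewrite ai imset_f // mem_porbit.
    have e : (rho ^+ (i + i)) x = (rho ^+ 0) x.
      by rewrite rhoX_add -ai -aut_rho // -ai -permM aa !perm1.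
    have := rho_eq_mod lab bd e; rewrite mod0n addnn -mul2n => /eqP.
    rewrite -/(dvdn _ _) Gauss_dvdr ?coprimen2 -?subn1 ?oddB ?(negPf n_even) ?(ltnW V_gt1) //.
    rewrite subn1 /dvdn => /eqP i0; case/eqP: a1.
    by apply: (Aut_free conn (x := x)); rewrite // ai perm1 -(rho_mod lab bd) i0 perm1.
  case=> _ /imsetP[_ /porbitP[i ->] ->] ->; have [a a_s ax] := PP (r2 ((rho ^+ i) x)).
  have /liftsP[aA al] := a_s; split; last first.
    by rewrite -{1}lx -al ax (lab2 lab) lab_rho // lx.
  apply/involutionsP; exists a; split=> //.
    have refl_a : a x = (rho ^+ 0) (r2 ((rho ^+ i) x)) by rewrite perm1.
    exact: (refl_involution conn aA refl_a).
  apply: contra_not_neq (@star_disjoint _ bd i 0 x) => a1.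
  by rewrite -ax a1 !perm1.
have sumI : (\sum_u #|inv_stab u| = n * n.-1)%N.
  by under eq_bigr do rewrite stab_card; rewrite sum_nat_const cardT -cardE.
have /card_gt0P[u _] : 0 < n by apply: ltnW.
have I_le : #|involutions| <= 3 * n.-1.
  by have := card_involutions_le u; rewrite stab_card -mulSn.
have sum_le : (\sum_(s in involutions) #|[set u | s u == u]| <= 2 * #|involutions|)%N.
  by rewrite mulnC -sum_nat_const leq_sum.
have n1 : 0 < n.-1 by rewrite -subn1 subn_gt0.
split.
  have : n * n.-1 <= 6 * n.-1.
    rewrite -sumI sum_card_exchange (leq_trans sum_le) //.
    by rewrite -[6]/(2 * 3)%N -mulnA leq_mul2l.
  by rewrite leq_pmul2r.
move=> n6 s sI; have I15 : #|involutions| <= 15 by rewrite n6 in I_le.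
have fix2 : #|[set u | s u == u]| = 2.
  apply/eqP; rewrite eqn_leq fix_le2 //= leqNgt; apply/negP => lt2.
  have : \sum_(s in involutions) #|[set u | s u == u]| < 2 * #|involutions|.
    rewrite mulnC -sum_nat_const (bigD1 s) //= [ltnRHS](bigD1 s) //=.
    by rewrite -addSn leq_add // leq_sum // => t /andP[tI _]; apply: fix_le2.
  rewrite -sum_card_exchange sumI n6 ltnNge; case/negP.
  by rewrite (leq_trans (leq_mul (leqnn 2) I15)).
have /cards2P[v [w [vw e]]] : #|[set u | s u == u]| == 2 by rewrite fix2.
have fixE z : (s z == z) = (z \in [set v; w]) by rewrite -e inE.
by exists v, w; split=> //; apply/eqP; rewrite fixE !inE eqxx ?orbT.
Qed.

(** For n = 2h + 1, at most n involutions fix a given vertex u, namely n - 1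
reflections and the rotation by h steps.  This rotation and the h reflections
j |-> i - j with i odd fix no other vertex.  Those for distinct u are distinct, so
n(h + 1) <= n + 2(n - 1), impossible for n > 3. *)
Lemma regular_not_odd : ~~ odd n.
Proof.
apply/negP=> n_odd; pose h := n./2.
have n_h : n = (2 * h).+1 by rewrite -(odd_double_half n) n_odd mul2n.
have h_gt1 : 1 < h by have := V_gt3; rewrite n_h; lia.
have n1_h : n.-1 = (2 * h)%N by rewrite n_h.
pose J u := [set s in involutions | [set v | s v == v] == [set u]].
have stab_le u : #|inv_stab u| <= n.
  have [x lx] := lab_surj lab V_gt1 u; have [P [P_inj PP PE]] := regular_lifts x.
  apply: (@leq_trans #|P @: ((rho ^+ h) x |: r2 @: porbit rho x)|); last first.
    rewrite card_imset // cardsU1 card_imset ?(card_star lab bd); last exact: perm_inj.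
    by rewrite -[leqRHS]prednK ?(ltnW V_gt1) // -add1n leq_add2r leq_b1.
  apply/subset_leq_card/subsetP=> s /setIdP[/involutionsP[a [a_s aa a1]] /eqP su].
  have /liftsP[aA al] := a_s; apply/imsetP; exists (a x); last exact: PE.
  have lax : l x = l (a x) by rewrite al lx su.
  have [i [ai|ai]] := star_cases lab lax; last by rewrite ai !inE imset_f ?orbT // mem_porbit.
  have e : (rho ^+ (i + i)) x = (rho ^+ 0) x.
    by rewrite rhoX_add -ai -aut_rho // -ai -permM aa !perm1.
  have := rho_eq_mod lab bd e; rewrite mod0n addnn -mul2n n1_h -muln_modr => /eqP.
  rewrite muln_eq0 /= => /eqP i0; rewrite ai !inE -(rho_mod lab bd) n1_h.
  have [q iq] : exists q, i = (q * h)%N by exists (i %/ h)%N; rewrite {1}(divn_eq i h) i0 addn0.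
  have : ~~ (2 %| q).
    apply: contra a1 => /dvdnP[t qt]; apply/eqP; apply: (Aut_free conn (x := x)) => //.
    by rewrite ai perm1 -(rho_mod lab bd) n1_h iq qt -mulnA modnMl perm1.
  rewrite dvdn2 negbK => q_odd; rewrite iq -(odd_double_half q) q_odd mulnDl mul1n.
  rewrite -muln2 -mulnA addnC modnMDl modn_small ?eqxx //.
  by rewrite -[ltnLHS]mul1n ltn_pmul2r // ltnW.
have J_ge u : h < #|J u|.
  have [x lx] := lab_surj lab V_gt1 u; have [P [P_inj PP PE]] := regular_lifts x.
  (* The targets of the reflections j |-> 2k + 1 - j, which fix no neighbour
     because n - 1 is even. *)
  pose odd_refl (k : 'I_h) := r2 ((rho ^+ (2 * k).+1) x).
  have odd_refl_inj : injective odd_refl.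
    move=> k k' /perm_inj e; have := rho_eq_mod lab bd e; rewrite n1_h.
    have lt_h (i : 'I_h) : (2 * i).+1 < 2 * h by have := ltn_ord i; lia.
    by rewrite !modn_small // => -[] /eqP; rewrite eqn_mul2l /= => /eqP/val_inj.
  have <- : #|P @: ((rho ^+ h) x |: odd_refl @: setT)| = h.+1.
    rewrite card_imset // cardsU1 card_imset // cardsT card_ord -[RHS]add1n.
    congr (_ + _)%N; case: imsetP => // -[k _] e.
    by case: (star_disjoint bd e).
  apply/subset_leq_card/subsetP=> _ /imsetP[y yx ->].
  have [a a_P ay] := PP y; have /liftsP[aA al] := a_P.
  have lyx : l y = u.
    case/setU1P: yx => [->|/imsetP[k _ ->]]; rewrite ?(lab2 lab) lab_rho //.
  have Pu : P y u = u by rewrite -{1}lx -al ay.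
  have y_inv : a * a = 1 /\ a != 1.
    split.
      case/setU1P: yx => [yh|/imsetP[k _ yk]].
        apply: (Aut_free conn (x := x)); rewrite ?groupM //.
        rewrite permM ay yh aut_rho // ay yh perm1 -rhoX_add addnn -mul2n -n1_h.
        exact: (rho_period lab bd).
      have refl_a : a x = (rho ^+ 0) (r2 ((rho ^+ (2 * k).+1) x)) by rewrite ay yk perm1.
      exact: (refl_involution conn aA refl_a).
    apply/eqP=> a1; move: ay; rewrite a1 perm1 => xy.
    case/setU1P: yx => [yh|/imsetP[k _ yk]]; last first.
      by case: (@star_disjoint _ bd (2 * k).+1 0 x); rewrite perm1 {1}xy yk.
    have e : (rho ^+ h) x = (rho ^+ 0) x by rewrite perm1 -yh.
    have := rho_eq_mod lab bd e; rewrite mod0n n1_h modn_small; last by lia.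
    by move=> h0; rewrite h0 in h_gt1.
  apply/setIdP; split; first by apply/involutionsP; exists a; case: y_inv.
  apply/eqP/setP=> v; rewrite !inE; have [->|vu] := eqVneq v u; first by rewrite Pu eqxx.
  apply/negP=> /eqP Pv; have [|j jv] := nbr_surj lab (x := x) (v := v); first by rewrite lx.
  case/setU1P: yx => [yh|/imsetP[k _ yk]].
    have : nbr l x (h + j) = nbr l x (0 + j).
      by rewrite {1}/nbr rhoX_add -yh -ay -/(nbr l (a x) j) -(lifts_nbr _ _ a_P) jv Pv.
    move/(nbr_eq_mod lab bd)/eqP; rewrite eqn_modDr mod0n n1_h modn_small; last by lia.
    by move=> /eqP h0; rewrite h0 in h_gt1.
  pose j' := (j %% n.-1)%N; have j'_lt : j' < 2 * h by rewrite /j' n1_h ltn_mod; lia.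
  have j'v : nbr l x j' = v by rewrite -jv /nbr (rho_mod lab bd).
  have e : P y (nbr l x j') = nbr l x ((2 * k).+1 + 2 * h - j').
    apply: (refl_nbr lab a_P); rewrite subnK ?ay ?yk; last by lia.
    by rewrite addnC rhoX_add -n1_h (rho_period lab bd).
  have par : (2 * k).+1 + 2 * h - j' = j' %[mod 2 * h].
    have : nbr l x ((2 * k).+1 + 2 * h - j') = nbr l x j' by rewrite -e j'v Pv.
    by move/(nbr_eq_mod lab bd); rewrite n1_h.
  have odd2h i : odd (i %% (2 * h)) = odd i by rewrite odd_mod // oddM.
  have /(congr1 odd) := par; rewrite !odd2h oddB; last by lia.
  by rewrite oddD /= !oddM /=; case: (odd j').
have sumJ : (\sum_u #|J u|) <= #|involutions|.
  rewrite sum_card_exchange -sum1_card leq_sum // => s _.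
  apply/card_le1P => v; rewrite inE => /eqP e w; rewrite !inE e.
  by apply/eqP/eqP => [/setP/(_ v)|->] //; rewrite !inE eqxx => /esym/eqP.
have /card_gt0P[u _] : 0 < n by apply: ltnW.
have : n * h.+1 <= n + 2 * n.-1.
  apply: (@leq_trans (\sum_u #|J u|)); last first.
    by rewrite (leq_trans sumJ) // (leq_trans (card_involutions_le u)) // leq_add2r.
  by rewrite -sum_nat_const leq_sum.
rewrite n_h /=; nia.
Qed.

End RegularMaps.

(** * Four vertices *)

Section DegreeFour.

Variable V : finType.
Hypothesis V4 : #|V| = 4.

Lemma perm_fix_three (s : {perm V}) u v w : u != v -> w != u -> w != v ->
  s u = u -> s v = v -> s w = w -> s = 1.
Proof.
move=> uv wu wv su sv sw; apply/permP=> z; rewrite perm1.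
have [->//|zu] := eqVneq z u; have [->//|zv] := eqVneq z v.
have [->//|zw] := eqVneq z w; apply/eqP; apply: contraT => szz.
have moved x : s x = x -> z != x -> s z != x.
  by move=> sx zx; rewrite -sx (inj_eq perm_inj).
have uniq5 : uniq [:: s z; z; w; v; u].
  by rewrite /= !inE !negb_or szz !moved // zu zv zw wu wv eq_sym uv.
by have := max_card (mem [:: s z; z; w; v; u]); rewrite (card_uniqP uniq5) V4.
Qed.

Lemma even_fix_two (s : {perm V}) u v : s \in 'Alt_V -> u != v ->
  s u = u -> s v = v -> s = 1.
Proof.
rewrite Alt_even => s_even uv su sv; apply/permP=> w; rewrite perm1.
apply/eqP; apply: contraT => sw.
have wu : w != u by apply: contraNneq sw => ->; rewrite su.
have wv : w != v by apply: contraNneq sw => ->; rewrite sv.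
have swu : s w != u by rewrite -su (inj_eq perm_inj).
have swv : s w != v by rewrite -sv (inj_eq perm_inj).
have : s * tperm w (s w) = 1.
  by apply: (perm_fix_three uv wu wv); rewrite permM ?su ?sv ?tpermR // tpermD.
move/(congr1 (@odd_perm V)); rewrite odd_permM odd_tperm odd_perm1 (negPf s_even).
by rewrite eq_sym sw.
Qed.

Variables (M : gmap) (l : flag M -> V).
Hypotheses (lab : labelling l) (conn : connected M) (bd : boundaryless M).
Hypothesis edge_tr : edge_transitive M.
Hypothesis reg : forall x y, exists2 a, a \in Aut_map M & a x = y.

Local Notation r0 := (R_0 M).
Local Notation r2 := (R_2 M).
Local Notation rho := (rho M).

Let V_gt3 : 3 < #|V|. Proof. by rewrite V4. Qed.
Let V_gt1 : 1 < #|V|. Proof. by rewrite V4. Qed.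

(** The images of a vertex and of two of its neighbours can be prescribed, by the
choice of an arc and of one of its two flags. *)
Lemma every_perm_lifts s : exists a, lifts l a s.
Proof.
have /card_gt0P[o _] : 0 < #|V| by apply: ltnW.
have [x _] := lab_surj lab V_gt1 o.
have [P [P_inj PP PE]] := regular_lifts lab conn bd V_gt3 reg x.
have nbrE i j : nbr l x i == nbr l x j = (i == j %[mod 3]).
  by apply/eqP/eqP => [/(nbr_eq_mod lab bd)|e]; [|apply/(nbr_eq_mod lab bd)]; rewrite V4.
have star_x i : l x != nbr l x i by rewrite eq_sym; apply: nbr_neq.
have [|y ly l0y] := @lab_complete _ _ _ lab (s (l x)) (s (nbr l x 0)).
  by rewrite (inj_eq perm_inj).
suffices [z [lz z0 z1]] : exists z, [/\ l z = s (l x), nbr l z 0 = s (nbr l x 0)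
    & nbr l z 1 = s (nbr l x 1)].
  have [a a_P ax] := PP z; exists a; have /liftsP[aA al] := a_P.
  suffices : P z * s^-1 = 1 by move/eqP; rewrite -eq_mulgV1 => /eqP <-.
  apply: (@perm_fix_three _ (l x) (nbr l x 0) (nbr l x 1)) => //.
  - by rewrite eq_sym.
  - by rewrite nbrE.
  - by rewrite permM -al ax lz permK.
  - by rewrite permM (lifts_nbr _ _ a_P) ax z0 permK.
  by rewrite permM (lifts_nbr _ _ a_P) ax z1 permK.
have y0 : nbr l y 0 = s (nbr l x 0) by rewrite /nbr perm1.
have [|j yj] := nbr_surj lab (x := y) (v := s (nbr l x 1)).
  by rewrite ly (inj_eq perm_inj) eq_sym.
have y_mod : nbr l y (j %% 3) = s (nbr l x 1).
  by rewrite -yj /nbr; have := rho_mod lab bd j y; rewrite V4 => ->.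
have : (j %% 3 < 3)%N by rewrite ltn_mod.
case: (j %% 3)%N y_mod => [|[|[|//]]] yj' _.
- by move/eqP: (yj'); rewrite y0 (inj_eq perm_inj) nbrE.
- by exists y.
exists (r2 y); split; first by rewrite (lab2 lab).
  by rewrite -y0 /nbr !perm1 R02C (lab2 lab).
rewrite -yj' /nbr; have := rho_period lab bd y; rewrite V4 /= => y3.
rewrite -{1}y3 -[3]/(2 + 1)%N rhoX_add rho_r2.
by rewrite R02C (lab2 lab).
Qed.

(** The alternating group is sharply 2-transitive on four points.  An odd element
taking one pair to another is corrected by the transposition of the target pair. *)
Theorem regular_four : power_cayley_map M #|V| \/ shuffled_cayley_map M #|V|.
Proof.
have free h u v : h \in 'Alt_V -> u != v -> h u = u -> h v = v -> h = 1.
  exact: even_fix_two.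
apply: (rotary_map lab conn bd V_gt3 (H := 'Alt_V) _ _ free).
- by move=> h _; apply: every_perm_lifts.
- move=> u v u' v' uv u'v'.
  have [h _ huv] := vertex_group_homog lab V_gt3 edge_tr uv u'v'.
  have [h_odd|h_even] := boolP (odd_perm h); last by exists h; rewrite ?Alt_even.
  exists (h * tperm u' v').
    by rewrite Alt_even odd_permM odd_tperm h_odd u'v'.
  by rewrite !permM; case: huv => -[-> ->]; rewrite tpermL tpermR; auto.
move=> a h x hA a_h hx; have /liftsP[aA al] := a_h.
have lax : l x = l (a x) by rewrite al hx.
have [i [ai|ai]] := star_cases lab lax; [by exists i | exfalso].
(* 2i is a solution of 2j = i modulo 3. *)
have fix_nbr : h (nbr l x (2 * i)) = nbr l x (2 * i).
  apply: (refl_nbr lab a_h); rewrite ai; congr (r2 _).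
  have -> : (2 * i + 2 * i = i + 3 * i)%N by lia.
  rewrite -[LHS](rho_mod lab bd) -[RHS](rho_mod lab bd) V4; congr ((rho ^+ _) x).
  by rewrite addnC [(3 * i)%N]mulnC modnMDl.
have h1 : h = 1.
  by apply: free hA _ hx fix_nbr; rewrite eq_sym; apply: nbr_neq.
have a1 : a = 1 by apply: (lifts_faithful lab conn bd V_gt1 V_gt3); rewrite -h1.
by case: (@star_disjoint _ bd i 0 x); rewrite -ai a1 !perm1.
Qed.

End DegreeFour.

(** * Half of the icosahedron *)

Section Icosahedron.

Definition ico_vtx (i : nat) (s t : bool) : ico_vertex := ((i%:R)%R, s, t).

(** The vertex with index 5 and its neighbours, indexed 0 to 4 in cyclic order: one
vertex from each antipodal pair. *)
Definition ico_reps : seq ico_vertex :=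
  [:: ico_vtx 0 false true; ico_vtx 1 true true; ico_vtx 2 true true;
      ico_vtx 2 false true; ico_vtx 1 true false; ico_vtx 0 true true].

Definition ico_class (a : ico_vertex) : nat :=
  if a \in ico_reps then index a ico_reps else index (ico_neg a) ico_reps.

Definition ico_rep k := nth (ico_vtx 0 true true) ico_reps k.

(** The map that commutes with the antipode and sends the representatives to
[img]. *)
Definition ico_extend (img : seq ico_vertex) (a : ico_vertex) : ico_vertex :=
  let b := nth a img (ico_class a) in if a \in ico_reps then b else ico_neg b.

(** The symmetries taking the base flag, with vertices indexed 5, 0 and 1, to its
images under R_0, R_1 and R_2 respectively. *)
Definition ico_sym (i : 'I_3) : ico_vertex -> ico_vertex :=
  ico_extend (nth [::]
    [:: [:: ico_vtx 0 true true; ico_vtx 1 true true; ico_vtx 2 true false;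
            ico_vtx 2 false false; ico_vtx 1 true false; ico_vtx 0 false true];
        [:: ico_vtx 1 true true; ico_vtx 0 false true; ico_vtx 1 true false;
            ico_vtx 2 false true; ico_vtx 2 true true; ico_vtx 0 true true];
        [:: ico_vtx 0 false true; ico_vtx 1 true false; ico_vtx 2 false true;
            ico_vtx 2 true true; ico_vtx 1 true true; ico_vtx 0 true true]] i).

(** The effect of [ico_sym] on antipodal pairs. *)
Definition ico_perm (i : 'I_3) (k : nat) : nat :=
  nth 0 (nth [::] [:: [:: 5; 1; 3; 2; 4; 0]; [:: 1; 0; 4; 3; 2; 5];
                      [:: 0; 4; 3; 2; 1; 5]] i)%N k.

Lemma ico_all (p : pred ico_vertex) : all p ico_enum -> forall a, p a.
Proof. by move/allP=> h a; apply: h; apply: mem_ico_enum. Qed.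

Lemma ico_all2 (p : ico_vertex -> ico_vertex -> bool) :
  all (fun a => all (p a) ico_enum) ico_enum -> forall a b, p a b.
Proof. by move=> h a b; apply: (ico_all (p := p a)); apply: (ico_all h). Qed.

Lemma ico_class_lt a : ico_class a < 6.
Proof. by apply: (ico_all (p := fun a => ico_class a < 6)); vm_compute. Qed.

Lemma ico_class_neg a : ico_class (ico_neg a) = ico_class a.
Proof.
by apply/eqP/(ico_all (p := fun a => ico_class (ico_neg a) == ico_class a)); vm_compute.
Qed.

Lemma ico_class_inj a b : ico_class a = ico_class b -> b = a \/ b = ico_neg a.
Proof.
move/eqP=> e; pose p a b := (ico_class a == ico_class b) ==> (b == a) || (b == ico_neg a).
have := ico_all2 (p := p); rewrite /p => /(_ _ a b); rewrite e.
by case/(_ _)/orP=> [|/eqP|/eqP]; [vm_compute | left | right].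
Qed.

Lemma ico_adj_antipode a b : ico_adj a b -> ico_adj a (ico_neg b) = false.
Proof.
move=> ab; pose p a b := ico_adj a b ==> ~~ ico_adj a (ico_neg b).
have : p a b by apply: (ico_all2 (p := p)); vm_compute.
by rewrite /p ab => /negPf.
Qed.

Lemma ico_sym_adj i a b : ico_adj (ico_sym i a) (ico_sym i b) = ico_adj a b.
Proof.
apply/eqP.
pose p i a b := ico_adj (ico_sym i a) (ico_sym i b) == ico_adj a b.
by case: i => [[|[|[|//]]] lt_i]; apply: (ico_all2 (p := p (Ordinal lt_i))); vm_compute.
Qed.

Lemma ico_sym_class i a : ico_class (ico_sym i a) = ico_perm i (ico_class a).
Proof.
apply/eqP; pose p i a := ico_class (ico_sym i a) == ico_perm i (ico_class a).
by case: i => [[|[|[|//]]] lt_i]; apply: (ico_all (p := p (Ordinal lt_i))); vm_compute.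
Qed.

End Icosahedron.

(** * Six vertices *)

Section SixVertices.

Variables (M : gmap) (V : finType) (l : flag M -> V).
Hypotheses (lab : labelling l) (conn : connected M) (bd : boundaryless M).
Hypothesis V6 : #|V| = 6.
Hypothesis reg : forall x y, exists2 a, a \in Aut_map M & a x = y.

Local Notation r0 := (R_0 M).
Local Notation r1 := (R_1 M).
Local Notation r2 := (R_2 M).
Local Notation rho := (rho M).

Let V_gt3 : 3 < #|V|. Proof. by rewrite V6. Qed.
Let V_gt1 : 1 < #|V|. Proof. by rewrite V6. Qed.

(** The same indexing as for the antipodal pairs of the icosahedron: 5 for the
vertex of [x] and 0 to 4 for its neighbours in cyclic order. *)
Definition vertex_at x (k : nat) := if k == 5 then l x else nbr l x k.

Lemma vertex_at_inj x j k : j < 6 -> k < 6 -> vertex_at x j = vertex_at x k -> j = k.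
Proof.
have nbr_lx i : nbr l x i <> l x by move=> e; have := nbr_neq lab x i; rewrite e eqxx.
rewrite /vertex_at => lt_j lt_k.
case: (eqVneq j 5) => [->|j5]; case: (eqVneq k 5) => [->|k5] // e.
- by case: (@nbr_lx k).
- by case: (@nbr_lx j).
move/(nbr_eq_mod lab bd): e; rewrite V6 !modn_small //.
  by rewrite ltn_neqAle k5 -ltnS.
by rewrite ltn_neqAle j5 -ltnS.
Qed.

Lemma vertex_at_surj x u : exists2 k, k < 6 & vertex_at x k = u.
Proof.
have [->|ux] := eqVneq u (l x); first by exists 5.
have [j <-] := nbr_surj lab ux; exists (j %% 5)%N; first by rewrite ltnS ltnW ?ltn_mod.
rewrite /vertex_at ltn_eqF ?ltn_mod //.
by rewrite /nbr; have := rho_mod lab bd j x; rewrite V6 => ->.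
Qed.

Lemma r1_rho x : r1 x = r2 (rho x).
Proof. by rewrite rhoE R2K. Qed.

Lemma r1r2_rho x : r1 (r2 x) = (rho ^+ 4) x.
Proof.
apply: (@perm_inj _ rho); rewrite -rhoSr rhoE R1K R2K.
by have := rho_period lab bd x; rewrite V6.
Qed.

Lemma refl_vertex_at x a (s : {perm V}) i j k : lifts l a s -> j != 5 -> k != 5 ->
  a x = r2 ((rho ^+ i) x) -> (k + j = i %[mod 5]) -> s (vertex_at x j) = vertex_at x k.
Proof.
move=> a_s j5 k5 ax e; rewrite /vertex_at (negPf j5) (negPf k5).
apply: (refl_nbr lab a_s); rewrite ax; congr (r2 _).
rewrite -[LHS](rho_mod lab bd) -[RHS](rho_mod lab bd) V6.
by congr ((rho ^+ _) x); rewrite /= e.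
Qed.

Lemma reflection_r2 x a (s : {perm V}) k : lifts l a s -> a x = r2 x -> k < 6 ->
  s (vertex_at x k) = vertex_at x (ico_perm (inord 2) k).
Proof.
move=> a_s ax lt_k; rewrite /ico_perm inordK //; have /liftsP[aA al] := a_s.
have refl_a : a x = r2 ((rho ^+ 0) x) by rewrite perm1.
case: k lt_k => [|[|[|[|[|[|//]]]]]] _; try exact: (refl_vertex_at a_s _ _ refl_a).
by rewrite /vertex_at /= -al ax (lab2 lab).
Qed.

Lemma reflection_r1 x a (s : {perm V}) k : lifts l a s -> a x = r1 x -> k < 6 ->
  s (vertex_at x k) = vertex_at x (ico_perm (inord 1) k).
Proof.
move=> a_s ax lt_k; rewrite /ico_perm inordK //; have /liftsP[aA al] := a_s.
have refl_a : a x = r2 ((rho ^+ 1) x) by rewrite ax r1_rho expg1.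
case: k lt_k => [|[|[|[|[|[|//]]]]]] _; try exact: (refl_vertex_at a_s _ _ refl_a).
by rewrite /vertex_at /= -al ax (lab1 lab).
Qed.

Lemma flip_r0 x a (s : {perm V}) : lifts l a s -> a x = r0 x ->
  s (vertex_at x 5) = vertex_at x 0 /\ s (vertex_at x 0) = vertex_at x 5.
Proof.
move=> a_s ax; have /liftsP[aA al] := a_s; have /Aut_mapP[a0 _ _] := aA.
by rewrite /vertex_at /nbr !perm1 /= -!al a0 ax R0K.
Qed.

Lemma flip_reflection_commute x a b (s t : {perm V}) :
  lifts l a s -> a x = r0 x -> lifts l b t -> b x = r2 x -> s * t = t * s.
Proof.
move=> a_s ax b_t bx; have /liftsP[aA _] := a_s; have /liftsP[bA _] := b_t.
have /Aut_mapP[_ _ a2] := aA; have /Aut_mapP[b0 _ _] := bA.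
have ab : a * b = b * a.
  apply: (Aut_free conn (x := x)); rewrite ?groupM //.
  by rewrite !permM ax b0 bx a2 ax R02C.
by apply: (lifts_uniq lab V_gt1 (liftsM a_s b_t)); rewrite ab; apply: liftsM.
Qed.

Lemma flip_r0_involution x a (s : {perm V}) : lifts l a s -> a x = r0 x -> s * s = 1.
Proof.
move=> a_s ax; have /liftsP[aA _] := a_s; have /Aut_mapP[a0 _ _] := aA.
apply: (lifts_uniq lab V_gt1 (liftsM a_s a_s)).
suffices -> : a * a = 1 by apply: lifts1.
by apply: (Aut_free conn (x := x)); rewrite ?groupM // permM ax a0 ax R0K perm1.
Qed.

(** The flip s agreeing with R_0 at [x] commutes with the reflection t agreeing
with R_2.  If s moved neighbour 1 to 2 or to 3, then commuting with t would make it
move all six vertices, but s is an involution and fixes two of them. *)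
Lemma triangle_or_petrie x a (s : {perm V}) :
    (forall s, s \in involutions l -> exists u v, [/\ u != v, s u = u & s v = v]) ->
    lifts l a s -> a x = r0 x ->
  s (vertex_at x 1) = vertex_at x 1 \/ s (vertex_at x 1) = vertex_at x 4.
Proof.
move=> fixed a_s ax; have [b bA bx] := reg x (r2 x).
have [t b_t] := aut_lifts lab V_gt1 bA.
have st := flip_reflection_commute a_s ax b_t bx; have ss := flip_r0_involution a_s ax.
have tE k : k < 6 -> t (vertex_at x k) = _ := reflection_r2 b_t bx.
have [s5 s0] := flip_r0 a_s ax.
have sK u : s (s u) = u by rewrite -permM ss perm1.
have stE u : s (t u) = t (s u) by rewrite -!permM st.
have inj := @vertex_at_inj x.
have s_inv : s \in involutions l.
  apply/(involutionsP lab conn bd V_gt3); exists a; split=> //.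
    by apply: (lifts_inj lab conn bd V_gt1 V_gt3 (liftsM a_s a_s)); rewrite ss; apply: lifts1.
  by apply: contraTneq (lab0 lab x) => a1; rewrite -ax a1 perm1 eqxx.
have moves : (forall k, k < 6 -> s (vertex_at x k) <> vertex_at x k) -> False.
  have [u [v [_ su _]]] := fixed s s_inv; have [k lt_k ku] := vertex_at_surj x u.
  by move/(_ k lt_k); rewrite ku su.
have neq j k : j < 6 -> k < 6 -> j != k -> vertex_at x j <> vertex_at x k.
  by move=> lt_j lt_k /eqP jk /inj; auto.
have t2 : t (vertex_at x 2) = vertex_at x 3 by rewrite tE // /ico_perm inordK.
have t3 : t (vertex_at x 3) = vertex_at x 2 by rewrite tE // /ico_perm inordK.
have t1 : t (vertex_at x 1) = vertex_at x 4 by rewrite tE // /ico_perm inordK.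
have [k lt_k s1] := vertex_at_surj x (s (vertex_at x 1)).
have s4 : s (vertex_at x 4) = t (vertex_at x k) by rewrite -t1 stE s1.
case: k lt_k s1 s4 => [|[|[|[|[|[|//]]]]]] _ s1 s4; rewrite ?t2 ?t3 in s4; auto.
- by case: (neq 1%N 5) => //; rewrite -s0 s1 sK.
- have s2 : s (vertex_at x 2) = vertex_at x 1 by rewrite s1 sK.
  have s3 : s (vertex_at x 3) = vertex_at x 4 by rewrite -s4 sK.
  case: moves.
  by case=> [|[|[|[|[|[|//]]]]]] _; rewrite ?s0 ?s5 ?s4 ?s3 ?s2 -?s1; apply: neq.
- have s3 : s (vertex_at x 3) = vertex_at x 1 by rewrite s1 sK.
  have s2 : s (vertex_at x 2) = vertex_at x 4 by rewrite -s4 sK.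
  case: moves.
  by case=> [|[|[|[|[|[|//]]]]]] _; rewrite ?s0 ?s5 ?s4 ?s3 ?s2 -?s1; apply: neq.
by case: (neq 1%N 0%N) => //; rewrite -s5 s1 sK.
Qed.

Section Triangulation.

Hypothesis triangles : forall y, l (r0 (r1 (r0 y))) = l (r0 (r1 y)).

Lemma corner_r1 x : l (r0 (r1 x)) = vertex_at x 1.
Proof. by rewrite r1_rho R02C (lab2 lab) /vertex_at /nbr expg1. Qed.

(** The flip fixes neighbour 1 since the face is a triangle, hence also neighbour 4,
its image under a reflection commuting with the flip.  It exchanges 0 and 5, and it
cannot fix a third vertex, so it exchanges 2 and 3. *)
Lemma flip_r0_ico x a (s : {perm V}) k : lifts l a s -> a x = r0 x -> k < 6 ->
  s (vertex_at x k) = vertex_at x (ico_perm (inord 0) k).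
Proof.
move=> a_s ax lt_k; have /liftsP[aA al] := a_s; have /Aut_mapP[a0 a1 _] := aA.
have [b bA bx] := reg x (r2 x); have [t b_t] := aut_lifts lab V_gt1 bA.
have st := flip_reflection_commute a_s ax b_t bx; have ss := flip_r0_involution a_s ax.
have tE j : j < 6 -> t (vertex_at x j) = _ := reflection_r2 b_t bx.
have [s5 s0] := flip_r0 a_s ax.
have sK u : s (s u) = u by rewrite -permM ss perm1.
have stE u : s (t u) = t (s u) by rewrite -!permM st.
have inj := @vertex_at_inj x.
have s1 : s (vertex_at x 1) = vertex_at x 1.
  by rewrite -corner_r1 -al a0 a1 ax triangles.
have t1 : t (vertex_at x 1) = vertex_at x 4 by rewrite tE // /ico_perm inordK.
have s4 : s (vertex_at x 4) = vertex_at x 4 by rewrite -t1 stE s1.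
have s_neq1 : s <> 1.
  by move=> s_1; move: s5; rewrite s_1 perm1 => e; have := inj 5 0%N isT isT e.
have sG : s \in vertex_group l by apply/vertex_groupP; exists a.
have n_even : ~~ odd #|V| by rewrite V6.
have neq i j : i < 6 -> j < 6 -> i != j -> vertex_at x i != vertex_at x j.
  by move=> lt_i lt_j; apply: contra_neq => /inj; auto.
have s23 i : i \in [:: 2; 3] -> s (vertex_at x i) != vertex_at x i.
  move=> i23; apply/eqP=> si; case: s_neq1.
  have lt_i : i < 6 by move: i23; rewrite !inE => /orP[] /eqP->.
  apply: (even_fix_three lab conn bd V_gt3 n_even sG _ _ _ s1 s4 si); apply: neq => //.
    by move: i23; rewrite !inE => /orP[] /eqP->.
  by move: i23; rewrite !inE => /orP[] /eqP->.
have s2 : s (vertex_at x 2) = vertex_at x 3.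
  have [j lt_j sj] := vertex_at_surj x (s (vertex_at x 2)); rewrite -sj.
  have := s23 2 isT; have s_inj := @perm_inj _ s.
  case: j lt_j sj => [|[|[|[|[|[|//]]]]]] _ sj //.
  - by have /eqP[] := neq 5 2 isT isT isT; apply: s_inj; rewrite s5.
  - by have /eqP[] := neq 1%N 2 isT isT isT; apply: s_inj; rewrite s1.
  - by rewrite -sj eqxx.
  - by have /eqP[] := neq 4 2 isT isT isT; apply: s_inj; rewrite s4.
  by have /eqP[] := neq 0%N 2 isT isT isT; apply: s_inj; rewrite s0.
have s3 : s (vertex_at x 3) = vertex_at x 2 by rewrite -s2 sK.
by rewrite /ico_perm inordK //; case: k lt_k => [|[|[|[|[|[|//]]]]]] _.
Qed.

(** A flag is determined by its vertex, the other end of its edge and the third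
vertex of its face.  Along every path of flags the automorphisms of M lift to
symmetries of the icosahedron, so these triples are the same as those of
antipodal pairs of flags of the icosahedron. *)
Theorem triangular_iso : map_iso M map_35_5.
Proof.
have /card_gt0P[o _] : 0 < #|V| by apply: ltnW.
have [x _] := lab_surj lab V_gt1 o.
have [P [P_inj PP PE]] := regular_lifts lab conn bd V_gt3 reg x.
have [W WE] : exists W : ico_vertex -> V, forall a, W a = vertex_at x (ico_class a).
  by exists (fun a => vertex_at x (ico_class a)).
have W_eq a b : W a = W b -> b = a \/ b = ico_neg a.
  by rewrite !WE => /(vertex_at_inj (ico_class_lt a) (ico_class_lt b))/ico_class_inj.
have W_neg a : W (ico_neg a) = W a by rewrite !WE ico_class_neg.
(* [g] lifts the automorphism taking [x] to [y] to the icosahedron. *)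
pose Q y := exists g : ico_vertex -> ico_vertex,
  (forall a b, ico_adj (g a) (g b) = ico_adj a b) /\ (forall a, W (g a) = P y (W a)).
have PM y a s : lifts l a s -> a x = y -> P y = s by move=> a_s <-; rewrite -(PE _ _ a_s).
have Qstep y (r : {perm flag M}) i : (forall a z, a \in Aut_map M -> a (r z) = r (a z)) ->
    (forall k, k < 6 -> P (r x) (vertex_at x k) = vertex_at x (ico_perm i k)) ->
    Q y -> Q (r y).
  move=> rA Pr [g [g_adj gW]]; exists (g \o ico_sym i); split=> [a b|a] /=.
    by rewrite g_adj ico_sym_adj.
  have [b b_P bx] := PP y; have [c c_P cx] := PP (r x).
  have -> : P (r y) = P (r x) * P y.
    apply: PM (liftsM c_P b_P) _; rewrite permM cx.
    by have /liftsP[bA _] := b_P; rewrite rA // bx.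
  by rewrite permM gW !WE Pr ?ico_class_lt // ico_sym_class.
have Qall y : Q y.
  have autE a z : a \in Aut_map M -> [/\ a (r0 z) = r0 (a z), a (r1 z) = r1 (a z)
      & a (r2 z) = r2 (a z)] by case/Aut_mapP.
  apply: (flag_ind conn (P := Q) (x := x)) => [z|z|z|].
  - apply: (Qstep _ _ (inord 0)) => [a w /autE-/(_ w)[]//|k].
    by have [c c_P cx] := PP (r0 x); apply: flip_r0_ico c_P cx.
  - apply: (Qstep _ _ (inord 1)) => [a w /autE-/(_ w)[]//|k].
    by have [c c_P cx] := PP (r1 x); apply: reflection_r1 c_P cx.
  - apply: (Qstep _ _ (inord 2)) => [a w /autE-/(_ w)[]//|k].
    by have [c c_P cx] := PP (r2 x); apply: reflection_r2 c_P cx.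
  exists id; split=> // a.
  by rewrite (PM x _ _ (lifts1 l)) ?perm1.
have [class5 class0 class1 class4] : [/\ ico_class (ico_rep 5) = 5, ico_class (ico_rep 0) = 0%N,
    ico_class (ico_rep 1%N) = 1%N & ico_class (ico_rep 4) = 4] by split; vm_compute.
have W5 : W (ico_rep 5) = l x by rewrite WE class5.
have W0 : W (ico_rep 0) = l (r0 x) by rewrite WE class0 /vertex_at /nbr /= perm1.
have W1 : W (ico_rep 1%N) = l (r0 (r1 x)) by rewrite WE class1 corner_r1.
have W4 : W (ico_rep 4) = l (r0 (r1 (r2 x))) by rewrite WE class4 r1r2_rho.
have tri_y y : [/\ l y = P y (W (ico_rep 5)), l (r0 y) = P y (W (ico_rep 0)),
    l (r0 (r1 y)) = P y (W (ico_rep 1)) & l (r0 (r1 (r2 y))) = P y (W (ico_rep 4))].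
  have [a a_P ax] := PP y; have /liftsP[aA al] := a_P.
  have /Aut_mapP[a0 a1 a2] := aA; rewrite -ax -a2 -!a1 -!a0 !al.
  by rewrite W5 W0 W1 W4 ax.
have base_flag : ico_is_flag (ico_rep 5, ico_rep 0, ico_rep 1) by vm_compute.
have [adj54 adj04] : ico_adj (ico_rep 5) (ico_rep 4) /\ ico_adj (ico_rep 0) (ico_rep 4) by split; vm_compute.
pose tri y := (l y, l (r0 y), l (r0 (r1 y))).
pose lab3 (t : ico_flag) := let: (a, b, c) := val t in (W a, W b, W c).
have adj_same a b b' : ico_adj a b -> ico_adj a b' -> W b' = W b -> b' = b.
  move=> ab ab' /W_eq[//|e]; by rewrite e (ico_adj_antipode ab') in ab.
(* The antipode turns a lift into another one, so the image of the base vertex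
   can be prescribed. *)
have sym_at y a : W a = l y -> exists g : ico_vertex -> ico_vertex,
    [/\ forall a b, ico_adj (g a) (g b) = ico_adj a b, forall a, W (g a) = P y (W a)
       & g (ico_rep 5) = a].
  have [-> _ _ _] := tri_y y; have [g [g_adj gW]] := Qall y.
  rewrite -gW => /esym/W_eq[e|e]; first by exists g.
  exists (fun v => ico_neg (g v)); split=> [v w|v|]; rewrite ?ico_adj_neg ?W_neg //.
have flag_sym y (t : ico_flag) : lab3 t = tri y -> exists g : ico_vertex -> ico_vertex,
    [/\ forall a b, ico_adj (g a) (g b) = ico_adj a b, forall a, W (g a) = P y (W a)
       & val t = (g (ico_rep 5), g (ico_rep 0), g (ico_rep 1))].
  case: t => [[[a b] c] abc]; rewrite /lab3 /tri /= => -[ea].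
  have [_ -> -> _] := tri_y y; have [g [g_adj gW ga]] := sym_at y a ea.
  rewrite -(gW (ico_rep 0)) -(gW (ico_rep 1%N)) => eb ec; have /and3P[ab ac bc] := abc.
  have /and3P[adj50 adj51 adj01] := base_flag.
  exists g; split=> //; rewrite -ga in ab ac *; congr (_, _, _).
    by apply: (adj_same (g (ico_rep 5))) ab _; rewrite ?g_adj.
  by apply: (adj_same (g (ico_rep 5))) ac _; rewrite ?g_adj.
have lab3_R0 t y : lab3 t = tri y -> lab3 (ico_R0 t) = tri (r0 y).
  case: t => [[[a b] c] abc]; rewrite /lab3 /tri /= => -[-> -> ->].
  by rewrite R0K triangles.
have lab3_R1 t y : lab3 t = tri y -> lab3 (ico_R1 t) = tri (r1 y).
  case: t => [[[a b] c] abc]; rewrite /lab3 /tri /= => -[-> -> ->].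
  by rewrite R1K (lab1 lab).
have lab3_R2 t y : lab3 t = tri y -> lab3 (ico_R2 t) = tri (r2 y).
  move=> e; have [g [g_adj gW]] := flag_sym y t e; move: e.
  case: t => [[[a b] c] abc]; rewrite /lab3 /tri /= => -[ea eb ec] [ta tb tc].
  rewrite R02C !(lab2 lab) ea eb; congr (_, _, _).
  have [_ _ _ ->] := tri_y y; rewrite -gW; congr W.
  have [_ _ _ uniq] := ico_oppP abc; symmetry; apply: uniq.
  - rewrite tc; apply/eqP=> /(congr1 W); rewrite !gW => /perm_inj.
    by rewrite !WE => /(vertex_at_inj (ico_class_lt _) (ico_class_lt _)).
  - by rewrite ta g_adj.
  by rewrite tb g_adj.
have tri_inj y y' : tri y = tri y' -> y = y'.
  case=> e1 e2 e3; have [//|y'y] := lab_arc lab e1 e2.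
  move: e3; rewrite y'y; have [_ _ -> ->] := tri_y y => /perm_inj.
  by rewrite !WE => /(vertex_at_inj (ico_class_lt _) (ico_class_lt _)).
have tri_flag y : exists t, lab3 t = tri y.
  have [g [g_adj gW]] := Qall y.
  have gflag : ico_is_flag (g (ico_rep 5), g (ico_rep 0), g (ico_rep 1)) by rewrite /= !g_adj.
  exists (exist (fun t => is_true (ico_is_flag t)) _ gflag); rewrite /lab3 /tri /= !gW.
  by have [-> -> -> _] := tri_y y.
have flag_tri t : exists y, lab3 t = tri y.
  case: t => [[[a b] c] abc]; have /and3P[ab ac bc] := abc.
  have Wab : W a != W b.
    have irr d : ~~ ico_adj d d && ~~ ico_adj d (ico_neg d).
      by apply: (ico_all (p := fun d => ~~ ico_adj d d && ~~ ico_adj d (ico_neg d))); vm_compute.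
    by apply/eqP=> /W_eq[e|e]; have := irr a; rewrite e in ab; rewrite ab ?andbF.
  have [y ly l0y] := lab_complete lab Wab.
  have [g [g_adj gW ga]] := sym_at y a (esym ly).
  have /and3P[adj50 adj51 adj01] := base_flag.
  have gb : b = g (ico_rep 0).
    apply: (adj_same a) ab _; first by rewrite -ga g_adj.
    by rewrite gW; have [_ <- _ _] := tri_y y.
  have gabc : ico_is_flag (a, b, g (ico_rep 1)) by rewrite /= ab gb -ga !g_adj adj51.
  have [ec|c1] := eqVneq c (g (ico_rep 1)).
    exists y; rewrite /lab3 /tri /= -ly -l0y ec gW.
    by have [_ _ <- _] := tri_y y.
  exists (r2 y); rewrite /lab3 /tri /= R02C !(lab2 lab) -ly -l0y.
  have [_ _ _ ->] := tri_y y; rewrite -gW; congr (_, _, W _).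
  have [_ _ _ uniq] := ico_oppP gabc; rewrite (uniq c) //; symmetry; apply: uniq.
  - apply/eqP=> /(congr1 W); rewrite !gW => /perm_inj.
    by rewrite !WE => /(vertex_at_inj (ico_class_lt _) (ico_class_lt _)).
  - by rewrite -ga g_adj.
  by rewrite gb g_adj.
have antipode_lab3 t : lab3 (ico_antipode t) = lab3 t.
  by rewrite permE; case: t => [[[a b] c] abc]; rewrite /lab3 /= !W_neg.
have orbitE t : orbit 'P <[ico_antipode]> t = [set t; ico_antipode t].
  have sq : ico_antipode ^+ 2 = 1.
    by apply/permP=> u; rewrite expgS expg1 permM !permE ico_antipodeK.
  apply/setP=> u; apply/orbitP/set2P.
    case=> _ /cycleP[i ->] <-; rewrite /= apermE -(expg_mod _ sq) modn2.
    by case: (odd i); rewrite ?expg1 ?expg0 ?perm1; auto.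
  case=> ->; first by exists 1; rewrite ?group1 //= apermE perm1.
  by exists ico_antipode; rewrite ?cycle_id.
have lab3_inj t t' : lab3 t = lab3 t' -> t' \in [set t; ico_antipode t].
  rewrite !inE -!(inj_eq val_inj) permE.
  case: t t' => [[[a b] c] abc] [[[a' b'] c'] abc']; rewrite /lab3 /=.
  have /and3P[ab ac _] := abc; have /and3P[ab' ac' _] := abc'.
  case=> ea eb ec; have [e|e] := W_eq _ _ ea; rewrite e in ab' ac' *; apply/orP.
    left; apply/eqP; congr (_, _, _); first exact: adj_same ab ab' _.
    exact: adj_same ac ac' _.
  right; apply/eqP; congr (_, _, _).
    by apply: adj_same ab' _; rewrite ?W_neg ?ico_adj_neg.
  by apply: adj_same ac' _; rewrite ?W_neg ?ico_adj_neg.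
have fP y : [set t | lab3 t == tri y] \in orbit 'P <[ico_antipode]> @: [set: ico_flag].
  have [t e] := tri_flag y; apply/imsetP; exists t => //; rewrite orbitE.
  apply/setP=> t'; rewrite inE -e; apply/eqP/idP => [/esym/lab3_inj //|].
  by case/set2P=> ->.
pose f y : flag map_35_5 := exist (fun B : {set ico_flag} =>
  is_true (B \in orbit 'P <[ico_antipode]> @: [set: ico_flag])) _ (fP y).
have f_equiv (r : flag M -> flag M) (R : {perm flag ico_map}) (rK : involutive r)
    (RK : involutive R) :
    (forall t y, lab3 t = tri y -> lab3 (R t) = tri (r y)) ->
  forall y, [set t | lab3 t == tri (r y)] = R @: [set t | lab3 t == tri y].
  move=> Rr y; apply/setP=> t; rewrite inE; apply/eqP/imsetP => [e|[t' ]].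
    by exists (R t); rewrite ?RK // inE -[y]rK; apply/eqP/Rr.
  by rewrite inE => /eqP/Rr e ->.
exists f; split.
- apply: inj_surj_bij => [y y' /(congr1 val) /= e|[B BP]].
    have [t et] := tri_flag y; apply: tri_inj; rewrite -et.
    by have /setP/(_ t) := e; rewrite !inE et eqxx => /esym/eqP.
  have /imsetP[t _ Bt] := BP; have [y ey] := flag_tri t; exists y; apply: val_inj => /=.
  rewrite Bt orbitE; apply/setP=> t'; rewrite inE -ey; apply/eqP/idP => [/esym/lab3_inj //|].
  by case/set2P=> ->.
- move=> y; apply: val_inj; rewrite permE /=; apply: f_equiv; try exact: R0K.
  by move=> t z /lab3_R0; rewrite permE.
- move=> y; apply: val_inj; rewrite permE /=; apply: f_equiv; try exact: R1K.
  by move=> t z /lab3_R1; rewrite permE.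
move=> y; apply: val_inj; rewrite permE /=; apply: f_equiv; try exact: R2K.
by move=> t z /lab3_R2; rewrite permE.
Qed.

End Triangulation.

End SixVertices.

Section SixVerticesConclusion.

Variables (M : gmap) (V : finType) (l : flag M -> V).
Hypotheses (lab : labelling l) (conn : connected M) (bd : boundaryless M).
Hypothesis V6 : #|V| = 6.
Hypothesis reg : forall x y, exists2 a, a \in Aut_map M & a x = y.

(** If the face at [x] is not a triangle, then by [triangle_or_petrie] the Petrie
polygon is. *)
Theorem regular_six :
  (forall s, s \in involutions l -> exists u v, [/\ u != v, s u = u & s v = v]) ->
  iso_up_to_petrie M map_35_5.
Proof.
move=> fixed; have V_gt1 : 1 < #|V| by rewrite V6.
have /card_gt0P[o _] := ltnW V_gt1; have [x _] := lab_surj lab V_gt1 o.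
have [a aA ax] := reg x (R_0 M x); have [s a_s] := aut_lifts lab V_gt1 aA.
have corner : l (R_0 M (R_1 M (R_0 M x))) = s (vertex_at l x 1).
  have /Aut_mapP[a0 a1 _] := aA; have /liftsP[_ al] := a_s.
  by rewrite -(corner_r1 lab) -al a0 a1 ax.
have [s1|s1] := triangle_or_petrie lab conn bd V6 reg fixed a_s ax; rewrite s1 in corner.
  left; apply: (triangular_iso lab conn bd V6 reg) => y.
  have [b bA <-] := reg x y; have [t b_t] := aut_lifts lab V_gt1 bA.
  have /Aut_mapP[b0 b1 _] := bA; have /liftsP[_ bl] := b_t.
  by rewrite -b0 -!b1 -!b0 !bl corner (corner_r1 lab).
right; apply: iso_petrie_dual; have lab' := petrie_labelling lab.
have reg' x' y' : exists2 a, a \in Aut_map (petrie_dual M) & a x' = y'.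
  by rewrite petrie_Aut; apply: reg.
apply: (triangular_iso lab' (petrie_connected conn) (petrie_boundaryless lab bd) V6 reg') => y.
have [c cA cx] := reg x (R_2 M x); have [t c_t] := aut_lifts lab V_gt1 cA.
have corner' : l (R_0 M (R_1 M (R_2 M (R_0 M x)))) = vertex_at l x 1.
  rewrite -R02C -cx; have /Aut_mapP[c0 c1 _] := cA; have /liftsP[_ cl] := c_t.
  rewrite -c0 -c1 -c0 cl corner (reflection_r2 lab bd V6 c_t cx) //.
  by rewrite /ico_perm inordK.
have [b bA <-] := reg x y; have [u b_u] := aut_lifts lab V_gt1 bA.
have /Aut_mapP[b0 b1 b2] := bA; have /liftsP[_ bl] := b_u.
by rewrite /= !permM !(lab2 lab) -b0 -b2 -!b1 -!b0 !bl corner' (corner_r1 lab).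
Qed.

End SixVerticesConclusion.

(** * Two and three vertices *)

Section FewVertices.

Variables (M : gmap) (V : finType) (l : flag M -> V).
Hypotheses (lab : labelling l) (bd : boundaryless M).

Local Notation r0 := (R_0 M).
Local Notation r1 := (R_1 M).
Local Notation r2 := (R_2 M).

Lemma bij_of_card (T T' : finType) : #|T| = #|T'| -> exists f : T -> T', bijective f.
Proof.
move=> e; exists (fun x => enum_val (cast_ord e (enum_rank x))).
exists (fun y => enum_val (cast_ord (esym e) (enum_rank y))) => x;
  by rewrite enum_valK ?cast_ordK ?cast_ordKV enum_rankK.
Qed.

(** There is one arc at each vertex, so R_1 and R_2 coincide. *)
Theorem two_vertices : #|V| = 2 ->
  power_cayley_map M #|V|.
Proof.
move=> V2; have cardF : #|'F_2| = 2 by rewrite card_Fp.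
have unit1 (x : {unit 'F_2}) : x = 1.
  have nonzero (v : 'F_2) : v != 0%R -> v = 1%R.
    by case: v => -[|[|//]] lt_v // _; apply: val_inj.
  by apply/val_inj/nonzero; rewrite -unitfE (valP x).
have hc : primitive_element (1 : {unit 'F_2}).
  rewrite /primitive_element /generator; apply/eqP/setP=> x.
  by rewrite (unit1 x) inE group1.
exists 'F_2, 1, hc; split; first by rewrite cardF.
have [f f_bij] : exists f : V -> 'F_2, bijective f by apply: bij_of_card; rewrite V2.
have lab' := labelling_comp lab f_bij; set l' := f \o l in lab'.
have [x0 l0 l1] := @lab_complete _ _ _ lab' 0%R 1%R isT.
have elts (v : 'F_2) : v = 0%R \/ v = 1%R.
  by case: v => -[|[|//]] lt_v; [left | right]; apply: val_inj.
pose q (v : 'F_2) := if v == 0%R then x0 else r2 (r0 x0).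
have val1 : val (1 : {unit 'F_2}) = 1%R by [].
have q0 : q 0%R = x0 by [].
have q1 : q 1%R = r2 (r0 x0) by [].
have add11 : (1 + 1 = 0 :> 'F_2)%R by apply: val_inj.
have r12 y : r1 y = r2 y.
  have := rho_period lab bd y; rewrite V2 /= expg1 rhoE => e.
  by rewrite -[LHS](R2K) e.
left; apply: (cayley_of_section lab' bd (pt := fun v _ => q v)).
- by move=> v _; case: (elts v) => ->; rewrite ?q1 ?(lab2 lab') ?q0.
- move=> v x; rewrite (unit1 x) val1; case: (elts v) => ->.
    by rewrite q0 add0r.
  by rewrite q1 R02C (lab2 lab') R0K l0 add11.
- by move=> v x; rewrite r12.
move=> v x; rewrite (unit1 x) val1; case: (elts v) => ->.
  by rewrite add0r q0 q1 R2K.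
by rewrite add11 q0 q1 R02C R0K.
Qed.

End FewVertices.

Section ThreeVertices.

Lemma F3_third (v w : 'F_3) : w != v -> w != (v + 1)%R -> w = (v - 1)%R.
Proof. by case: v w => -[|[|[|//]]] ? [[|[|[|//]]] ?] // _ _; apply: val_inj. Qed.

Lemma F3_cases (v : 'F_3) : [\/ v = 0%R, v = 1%R | v = (-1)%R].
Proof.
by case: v => -[|[|[|//]]] lt_v; [apply: Or31 | apply: Or32 | apply: Or33]; apply: val_inj.
Qed.

Definition F3_gen : {unit 'F_3} := oppu 1.

Lemma val_F3_gen : val F3_gen = (-1)%R. Proof. by rewrite val_oppu. Qed.

Lemma F3_units (x : {unit 'F_3}) : x = 1 \/ x = F3_gen.
Proof.
case: (F3_cases (val x)) => e.
- by have := valP x; rewrite unitfE e eqxx.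
- by left; apply: val_inj.
by right; apply: val_inj; rewrite val_F3_gen.
Qed.

Lemma F3_primitive : primitive_element F3_gen.
Proof.
rewrite /primitive_element /generator; apply/eqP/setP=> x; rewrite inE.
by case: (F3_units x) => ->; rewrite ?group1 ?cycle_id.
Qed.

Variables (M : gmap) (l : flag M -> 'F_3).
Hypotheses (lab : labelling l) (bd : boundaryless M).

Local Notation r0 := (R_0 M).
Local Notation r1 := (R_1 M).
Local Notation r2 := (R_2 M).
Local Notation rho := (rho M).

Let cardF : #|'F_3| = 3. Proof. by rewrite card_Fp. Qed.

Lemma rho_involutive y : rho (rho y) = y.
Proof. by have := rho_period lab bd y; rewrite cardF /= rhoSr expg1. Qed.

Lemma rho_other y : l (r0 (rho y)) != l y /\ l (r0 (rho y)) != l (r0 y).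
Proof.
split; first by have := nbr_neq lab y 1; rewrite /nbr expg1.
apply/eqP=> e; have : nbr l y 1 = nbr l y 0 by rewrite /nbr perm1 expg1.
by move/(nbr_eq_mod lab bd); rewrite cardF.
Qed.

Definition arc_from v y := l y = v /\ l (r0 y) = (v + 1)%R.

Lemma arc_from_step v y : arc_from v y -> arc_from (v + 1)%R (r1 (r0 y)).
Proof.
case=> ly l0y; split; first by rewrite (lab1 lab).
have [n1 n2] := rho_other (r0 y); rewrite R0K ly l0y in n1 n2.
rewrite r1_rho R02C (lab2 lab) (F3_third n2 n1) -addrA; congr (_ + _)%R.
exact: val_inj.
Qed.

(** The circuit of length 3 walked by alternating R_0 and R_1 supplies one flag at
each vertex in consistent orientations. *)
Lemma three_vertices_closed x0 : arc_from 0%R x0 ->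
  r1 (r0 (r1 (r0 (r1 (r0 x0))))) = x0 -> map_iso M (M_c F3_primitive).
Proof.
move=> a0 closed; have a1 := arc_from_step a0; have a2 := arc_from_step a1.
pose q (v : 'F_3) := if v == 0%R then x0 else if v == 1%R then r1 (r0 x0)
  else r1 (r0 (r1 (r0 x0))).
have [q0 q1 q2] : [/\ q 0%R = x0, q 1%R = r1 (r0 x0) & q (-1)%R = r1 (r0 (r1 (r0 x0)))].
  by [].
have add11 : (1 + 1 = -1 :> 'F_3)%R by apply: val_inj.
have q_arc v : arc_from v (q v).
  by rewrite add0r in a1 a2; rewrite add11 in a2; case: (F3_cases v) => ->; rewrite ?q0 ?q1 ?q2.
have q_step v : r1 (r0 (q v)) = q (v + 1)%R.
  by case: (F3_cases v) => ->; rewrite ?add0r ?add11 ?addNr ?q0 ?q1 ?q2.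
pose pt v (x : {unit 'F_3}) := if x == 1 then q v else rho (q v).
have gen_neq1 : F3_gen != 1 by rewrite -(inj_eq val_inj) val_F3_gen.
have pt1 v : pt v 1 = q v by rewrite /pt eqxx.
have ptc v : pt v F3_gen = rho (q v) by rewrite /pt (negPf gen_neq1).
have l_pt v x : l (pt v x) = v.
  have [lq _] := q_arc v; case: (F3_units x) => ->; rewrite ?pt1 ?ptc //.
  by have := lab_rho lab 1 (q v); rewrite expg1 lq.
have l_r0c v : l (r0 (rho (q v))) = (v - 1)%R.
  have [lq l0q] := q_arc v; have [n1 n2] := rho_other (q v).
  by rewrite lq l0q in n1 n2; apply: F3_third.
apply: (cayley_of_section lab bd l_pt) => v x.
- case: (F3_units x) => ->; rewrite ?pt1 ?ptc ?l_r0c ?val_F3_gen //.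
  by case: (q_arc v).
- have -> : next (power_ordering F3_primitive) x = if x == 1 then F3_gen else 1.
    rewrite /= /power_seq cardF /= expg0 expg1.
    by case: (F3_units x) => ->; rewrite ?eqxx ?(negPf gen_neq1) // eq_sym (negPf gen_neq1).
  case: (F3_units x) => ->; rewrite ?eqxx ?(negPf gen_neq1) ?pt1 ?ptc r1_rho //.
  by rewrite rho_involutive.
case: (F3_units x) => ->.
  have -> : oppu 1 = F3_gen by [].
  by rewrite pt1 ptc -[q _ in RHS]q_step rhoE R1K R2K.
have -> : oppu F3_gen = 1 by apply: val_inj; rewrite val_oppu val_F3_gen opprK.
rewrite pt1 ptc val_F3_gen.
have -> : rho (q v) = r2 (r0 (q (v - 1)%R)).
  by rewrite -{1}[v](subrK 1%R) -q_step rhoE R1K.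
by rewrite R02C R0K.
Qed.

End ThreeVertices.

(** If the walk along the circuit returns to the other side of the first edge, then
it closes in the Petrie dual: R_2 commutes with R_1 since the degree is 2, and it is
inserted three times. *)
Theorem three_vertices (M : gmap) (V : finType) (l : flag M -> V) :
  labelling l -> boundaryless M -> #|V| = 3 ->
  power_cayley_map M #|V|.
Proof.
move=> lab bd V3; have cardF : #|'F_3| = 3 by rewrite card_Fp.
exists 'F_3, F3_gen, F3_primitive; split; first by rewrite cardF.
have [f f_bij] : exists f : V -> 'F_3, bijective f by apply: bij_of_card; rewrite V3.
have lab' := labelling_comp lab f_bij; set l' := f \o l in lab'.
have [x0 l0 l1] := @lab_complete _ _ _ lab' 0%R 1%R isT.
have a0 : arc_from l' 0%R x0 by split; rewrite ?add0r.
pose step y := R_1 M (R_0 M y).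
have [l3 l03] : arc_from l' 0%R (step (step (step x0))).
  have := arc_from_step lab' bd (arc_from_step lab' bd (arc_from_step lab' bd a0)).
  by congr (arc_from _ _ _); apply: val_inj.
have [||e|e] := @lab_arc _ _ _ lab' x0 (step (step (step x0))).
- by rewrite l0.
- by rewrite l1 l03 add0r.
- by left; apply: three_vertices_closed lab' bd _ a0 e.
right; apply: iso_petrie_dual.
have r12 y : R_1 M (R_2 M y) = R_2 M (R_1 M y).
  have := rho_involutive lab' bd (R_1 M y); rewrite !rhoE R1K => e2.
  by rewrite -e2 R2K.
have stepP y : R_1 M (R_2 M (R_0 M y)) = R_2 M (step y) by rewrite r12.
have step2 y : step (R_2 M y) = R_2 M (step y) by rewrite /step R02C r12.
apply: (three_vertices_closed (petrie_labelling lab') (petrie_boundaryless lab bd) (x0 := x0)).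
  by case: a0 => a01 a02; split; rewrite //= permM (lab2 lab').
by rewrite /= !permM !stepP !step2 e !R2K.
Qed.

(** * The classification *)

Lemma card_finField_prime_power (F : finFieldType) : prime_power #|F|.
Proof.
have [p p_pr pF] := finPcharP F; have cF := card_pprimeChar pF.
exists p, (logn p #|F|); split=> //.
rewrite lt0n; apply/eqP=> e; have := finNzRing_gt1 F.
by rewrite cF e.
Qed.

Theorem theorem5p5 (M : gmap) (n : nat)
    (hconn : connected M)
    (hbd : boundaryless M)
    (het : edge_transitive M)
    (hK : embeds M (complete_graph n)) :
  [\/ exists (F : finFieldType) (c : {unit F}) (hc : primitive_element c),
        [/\ prime_power n, #|F| = n & iso_up_to_petrie M (M_c hc)],
      [\/ n = 3 /\ iso_up_to_petrie M map_62_3,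
          n = 4 /\ iso_up_to_petrie M map_43_3,
          n = 6 /\ iso_up_to_petrie M map_35_5
        | n = 6 /\ iso_up_to_petrie M map_55_3]
    | exists (p e : nat) (F : finFieldType) (c : {unit F}) (j : nat)
             (hc : primitive_element c) (hF : odd #|F|) (hj : odd j),
        [/\ prime p, n = (p ^ e)%N, (3 < n)%N & (n = 3 %[mod 4])%N] /\
        [/\ #|F| = n, (j < n.-1)%N, j <> 1%N
          & iso_up_to_petrie M (M_cj hc hF hj)]]
  /\ (n = 6 \/ prime_power n).
Proof.
have [l lab] := embeds_labelling hK.
have card_n : #|'I_n| = n := card_ord n.
have n_gt1 : 1 < n.
  have /imsetP[x _ _] := hconn; have l0 := lab0 lab x.
  rewrite ltnNge; apply: contra l0 => n1; apply/eqP/val_inj => /=.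
  by have := ltn_ord (l x); have := ltn_ord (l (R_0 M x)); lia.
have [[F [c [hc [cF iso]]]]|[[F [c [j [hc [hF [hj [cF n3 j_lt j1 iso]]]]]]]|[n6 iso]]] :
    power_cayley_map M n \/ shuffled_cayley_map M n \/ n = 6 /\ iso_up_to_petrie M map_35_5.
- have [n_le3|n_gt3] := leqP n 3.
    left; have [n2|n3] : n = 2 \/ n = 3 by lia.
      by have := two_vertices lab hbd; rewrite card_n; apply.
    by have := three_vertices lab hbd; rewrite card_n; apply.
  have V_gt3 : 3 < #|'I_n| by rewrite card_n.
  have [h|reg] := rotary_or_regular lab hconn hbd V_gt3 het.
    by rewrite card_n in h; case: h; auto.
  have n_even := regular_not_odd lab hconn hbd V_gt3 reg.
  have [n_le6 fixed] := regular_even_le6 lab hconn hbd V_gt3 reg n_even.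
  rewrite card_n in n_even n_le6 fixed.
  have [n4|n6] : n = 4 \/ n = 6 by lia.
    by have := regular_four _ lab hconn hbd het reg; rewrite card_n => /(_ n4)[]; auto.
  right; right; split=> //.
  by apply: (regular_six lab hconn hbd _ reg (fixed n6)); rewrite card_n.
- have npp := card_finField_prime_power F; rewrite cF in npp.
  by split; [apply: Or31; exists F, c, hc | right].
- have npp := card_finField_prime_power F; rewrite cF in npp.
  split; last by right.
  have [p [e [p_pr _ npe]]] := npp; apply: Or33.
  exists p, e, F, c, j, hc, hF, hj; split; split=> //.
  have j_gt2 : 2 < j by case: (j) (hj) j1 => [|[|[|]]].
  exact: leq_trans (leq_ltn_trans j_gt2 j_lt) (leq_pred n).
split; last by left.
by apply/Or32/Or43.
Qed.
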